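(* Let $d\ge2$ be an integer, let $n,n'\ge0$ be integers and $N=\max\{n,n'\}$, and let $p,q$ be real with $p>2N+d$ and $q>-d$. For $m=0,1,\ldots$ let $\{Y_l^m:1\le l\le\dim\mathcal H_m^d\}$ be an orthonormal basis of $\mathcal H_m^d$, and for $0\le m\le n$, $1\le l\le\dim\mathcal H_m^d$ define $$S_{n,m,l}^{p,q,M}(x,t)=M_{n-m}^{(p-2m-d+1,\;q+2m+d-1)}(t)\,Y_l^m(x).$$ Then $\{S_{n,m,l}^{p,q,M}:0\le m\le n,\ 1\le l\le\dim\mathcal H_m^d\}$ is an orthogonal basis of $\mathcal V_n(\mathbb V_0^{d+1},w_{p,q})$, and for $0\le m\le n$, $0\le m'\le n'$, $1\le l\le\dim\mathcal H_m^d$, $1\le l'\le\dim\mathcal H_{m'}^d$, $$\left\langle S_{n,m,l}^{p,q,M},S_{n',m',l'}^{p,q,M}\right\rangle_{p,q}=H_{m,n}^{p,q,M}\,\delta_{n,n'}\delta_{l,l'}\delta_{m,m'},$$ where $$H_{m,n}^{p,q,M}=\frac{c_{p-d+1,\,q+d-1}}{c_{p-2m-d+1,\,q+2m+d-1}}\,h_{n-m}^{(p-2m-d+1,\,q+2m+d-1)}.$$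
   Context: Univariate polynomials: $M_n^{(p,q)}(x)=(-1)^n\frac{(1+x)^{p+q}}{x^q}\frac{d^n}{dx^n}\left(x^{n+q}(1+x)^{n-p-q}\right)$, a polynomial of degree at most $n$ in $x$. Constants: $c_{p,q}=\frac{\Gamma(p+q)}{\Gamma(p-1)\Gamma(q+1)}$ for $p>1$, $q>-1$, and $h_n^{(p,q)}=\frac{n!\,(p-n-1)!\,(p+q-1)!\,(q+1)_n}{(p-2)!\,(p-2n-1)\,(p+q-n-1)!}$, where $z!$ means $\Gamma(z+1)$ and $(a)_n=a(a+1)\cdots(a+n-1)$, $(a)_0=1$. Spherical harmonics: $\mathcal H_m^d$ is the space of homogeneous polynomials of degree $m$ in $d$ variables that are harmonic on $\mathbb R^d$; orthonormality is with respect to $\frac1{\varpi_d}\int_{\mathbb S^{d-1}}fg\,d\sigma$, where $d\sigma$ is surface measure on the unit sphere $\mathbb S^{d-1}$ and $\varpi_d=\frac{2\pi^{d/2}}{\Gamma(d/2)}$ is its total area. $Y_l^m(x)$ denotes the homogeneous polynomial on $\mathbb R^d$. Surface of the cone: $\mathbb V_0^{d+1}=\{(x,t):\|x\|=t,\ x\in\mathbb R^d,\ 0\le t<\infty\}$, with measure $d\sigma(x,t)$ given by $\int_{\mathbb V_0^{d+1}}f(x,t)\,d\sigma(x,t)=\int_0^\infty t^{d-1}\int_{\mathbb S^{d-1}}f(t\xi,t)\,d\sigma(\xi)\,dt$. Weight $w_{p,q}(t)=\frac{t^q}{(1+t)^{p+q}}$ and inner product $\langle f,g\rangle_{p,q}=b_{p,q}\int_{\mathbb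 V_0^{d+1}}f(x,t)g(x,t)w_{p,q}(t)\,d\sigma(x,t)$ with $b_{p,q}=\frac1{\varpi_d}c_{p-d+1,\,q+d-1}$, considered on polynomials in $(x,t)$ modulo the ideal generated by $\|x\|^2-t^2$ (i.e. restrictions of polynomials to $\mathbb V_0^{d+1}$). $\mathcal V_n(\mathbb V_0^{d+1},w_{p,q})$ is the space of (classes of) polynomials of degree at most $n$ orthogonal to all polynomials of degree less than $n$ with respect to $\langle\cdot,\cdot\rangle_{p,q}$. *)

(* Defs.v *)
From HB Require Import structures.
From mathcomp Require Import all_boot all_order all_algebra.
From mathcomp Require Import all_classical all_reals all_analysis.
From mathcomp Require Import -(notations) mpoly.
From mathcomp Require Import ring.

Set Implicit Arguments.
Unset Strict Implicit.
Unset Printing Implicit Defensive.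
Import Order.TTheory GRing.Theory Num.Theory.
Import numFieldNormedType.Exports.
Local Open Scope classical_set_scope.
Local Open Scope ring_scope.

(* The notations of mpoly cannot be loaded together with those of
   all_analysis; these are restated from it. *)
Notation "{ 'mpoly' T [ n ] }" := (mpoly n T)
  (at level 0, T, n at level 2, format "{ 'mpoly'  T [ n ] }") : type_scope.
Notation mX i := (@mpolyX _ _ (mnm1 i)).
Notation msize P := (@mmeasure _ _ (@mdeg _) P).
Notation homog_of_degree m := (@ishomog1 _ _ m (@mdeg _)).

Section GammaFunction.
Context {R : realType}.
Implicit Types (z a p q : R) (n : nat).

(* The Euler integral, used only for z > 0, where it converges. *)
Definition Gamma z : R :=
  \int[@lebesgue_measure R]_(t in `]0, +oo[) (t `^ (z - 1) * expR (- t)).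

Definition Gfact z : R := Gamma (z + 1).

Definition rising a n : R := \prod_(i < n) (a + i%:R).

Definition c_const p q : R := Gamma (p + q) / (Gamma (p - 1) * Gamma (q + 1)).

Definition h_const n p q : R :=
  (n`!%:R * Gfact (p - n%:R - 1) * Gfact (p + q - 1) * rising (q + 1) n)
  / (Gfact (p - 2) * (p - (2 * n)%:R - 1) * Gfact (p + q - n%:R - 1)).

End GammaFunction.

Section UnivariateM.
Context {R : realType}.
Implicit Types (p q x : R) (n : nat).

Definition rodrigues n p q x : R :=
  (-1) ^+ n * ((1 + x) `^ (p + q) / x `^ q)
  * derive1n n (fun y : R => y `^ (n%:R + q) * (1 + y) `^ (n%:R - p - q)) x.

(* The Rodrigues expression makes sense for x > 0 and is there the restriction
   of a unique polynomial, selected here; existence is [Mpoly_rodrigues]. *)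
Definition Mpoly n p q : {poly R} :=
  xget 0 [set P : {poly R} | forall x, 0 < x -> P.[x] = rodrigues n p q x].

Lemma derive1n_powR_mul (a b : R) k : exists P : {poly R}, forall x, 0 < x ->
  derive1n k (fun y : R => y `^ a * (1 + y) `^ b) x =
  x `^ (a - k%:R) * (1 + x) `^ (b - k%:R) * P.[x].
Proof.
elim: k => [|k [P hP]].
  by exists 1 => x _; rewrite /derive1n /= !subr0 hornerE mulr1.
exists (((a - k%:R) *: (1 + 'X) + (b - k%:R) *: 'X) * P
        + 'X * (1 + 'X) * deriv P) => x x0.
have x1 : 0 < 1 + x by rewrite addr_gt0.
rewrite derive1nS derive1E.
rewrite (@near_eq_derive _ _ _ _
  (fun y => y `^ (a - k%:R) * (1 + y) `^ (b - k%:R) * P.[y])); last first.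
  by near=> y; apply: hP; near: y; exact: lt_nbhsr.
set a' := a - k%:R; set b' := b - k%:R.
have D1 := is_derive1_powR a' x0.
have D2 : is_derive x (1 : R) (fun y : R => (1 + y) `^ b') (b' * (1 + x) `^ (b' - 1)).
  have D0 : is_derive x (1 : R) (fun y : R => 1 + y) (0 + 1).
    by apply: is_deriveD; exact: is_derive_cst.
  have := @is_derive1_comp _ _ _ x _ _ (is_derive1_powR b' x1) D0.
  by rewrite add0r mulr1.
have D3 : is_derive x (1 : R) (horner P) (deriv P).[x].
  by apply: DeriveDef; [exact: derivable_horner|rewrite -derive1E derivE].
have := is_deriveM (is_deriveM D1 D2) D3 => -[_ ->].
have powS (c y : R) : 0 < y -> y `^ c = y * y `^ (c - 1).
  move=> y0; rewrite -{2}(powRr1 (ltW y0)) -powRD; last by rewrite (gt_eqF y0) implybT.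
  by rewrite addrC subrK.
rewrite [X in X *: _ + _](_ : _ = x `^ a' * (1 + x) `^ b')//.
rewrite -natr1 !opprD !addrA -/a' -/b' (powS a')// (powS b')// !hornerE /=.
rewrite /GRing.scale /=; ring.
Unshelve. all: by end_near.
Qed.

Lemma Mpoly_rodrigues n p q x : 0 < x -> (Mpoly n p q).[x] = rodrigues n p q x.
Proof.
move: x; rewrite /Mpoly; case: xgetP => [P _ hP //|none].
have [P hP] := derive1n_powR_mul (n%:R + q) (n%:R - p - q) n.
case: (none ((-1) ^+ n *: P)) => x x0; rewrite /rodrigues hP//.
have -> : n%:R + q - n%:R = q by ring.
have -> : n%:R - p - q - n%:R = - (p + q) by ring.
rewrite powRN hornerZ.
have xq : x `^ q != 0 by rewrite gt_eqF// powR_gt0.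
have xp : (1 + x) `^ (p + q) != 0 by rewrite gt_eqF//; apply: powR_gt0; rewrite addr_gt0.
by field; rewrite xq xp.
Qed.

End UnivariateM.

Section Points.
Context {R : realType}.

(* The point (x_1, ..., x_d, t) of R^(d+1). *)
Definition snoc d (x : 'I_d -> R) (t : R) : 'I_d.+1 -> R :=
  fun i => if unlift ord_max i is Some j then x j else t.

(* Integral over the unit sphere of R^d against its surface measure, in
   spherical coordinates: for d >= 2 the sphere is parametrized by
   (sin theta * xi, cos theta), xi in the unit sphere of R^(d-1) and
   0 <= theta <= pi, with surface element
   (sin theta)^(d-2) dtheta dsigma(xi); the sphere of R^1 is {1, -1} with
   the counting measure. *)
Fixpoint sphere_integral (d : nat) : (('I_d -> R) -> R) -> R :=
  match d return (('I_d -> R) -> R) -> R with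
  | 0 => fun _ => 0
  | d1.+1 =>
    match d1 return ((('I_d1 -> R) -> R) -> R) ->
                    (('I_d1.+1 -> R) -> R) -> R with
    | 0 => fun _ f => f (fun _ => 1) + f (fun _ => -1)
    | k.+1 => fun rec f =>
        \int[@lebesgue_measure R]_(theta in `[0, pi])
          (sin theta ^+ k *
           rec (fun xi => f (snoc (fun i => sin theta * xi i) (cos theta))))
    end (@sphere_integral d1)
  end.

Definition sphere_area (d : nat) : R :=
  2 * pi `^ (d%:R / 2) / Gamma (d%:R / 2).

Definition cone_integral d (f : ('I_d -> R) -> R -> R) : R :=
  \int[@lebesgue_measure R]_(t in `[0, +oo[)
    (t ^+ d.-1 * sphere_integral (fun xi => f (fun i => t * xi i) t)).

End Points.

Section Harmonics.
Context {R : realType}.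

Definition laplacian d (P : {mpoly R[d]}) : {mpoly R[d]} :=
  \sum_(i < d) mderiv i (mderiv i P).

Definition harmonics (d m : nat) : set {mpoly R[d]} :=
  [set P | P \is homog_of_degree m /\ laplacian P = 0].

Definition sphere_inner d (P Q : {mpoly R[d]}) : R :=
  (sphere_area d)^-1 * sphere_integral (fun xi => meval xi P * meval xi Q).

End Harmonics.

Arguments harmonics {R} d m.

(* The image of the family b is a basis of the image of U in V / Z. *)
Definition basis_modulo (K : fieldType) (V : lmodType K) (Z U : set V)
    (I : finType) (b : I -> V) : Prop :=
  [/\ forall i, U (b i),
      forall c : I -> K, Z (\sum_i c i *: b i) -> forall i, c i = 0
    & forall v, U v -> exists c : I -> K, Z (v - \sum_i c i *: b i)].

(* The length k of the family is thereby the dimension of harmonics d m. *)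
Definition orthonormal_harmonic_basis (R : realType) (d m k : nat)
    (Y : 'I_k -> {mpoly R[d]}) : Prop :=
  basis_modulo [set 0] (harmonics d m) Y /\
  forall l l', sphere_inner (Y l) (Y l') = (l == l')%:R.

Section Cone.
Context {R : realType} {d : nat}.
Implicit Types (P Q : {mpoly R[d.+1]}) (p q t : R) (n m : nat).

(* In d.+1 variables, the last one (index ord_max) is t, the others are
   x_1, ..., x_d; this is also the convention of snoc and mwiden. *)
Definition cone_poly : {mpoly R[d.+1]} :=
  mwiden (\sum_(i < d) mX i ^+ 2) - mX ord_max ^+ 2.

Definition cone_ideal : set {mpoly R[d.+1]} :=
  [set P | exists Q, P = Q * cone_poly].

Definition weight p q t : R := t `^ q / (1 + t) `^ (p + q).

Definition cone_inner p q P Q : R :=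
  (sphere_area d)^-1 * c_const (p - d%:R + 1) (q + d%:R - 1)
  * cone_integral (fun x t =>
      meval (snoc x t) P * meval (snoc x t) Q * weight p q t).

(* A union of classes modulo cone_ideal; the degree of a class is the least
   degree of its representatives, and msize is the degree plus one. *)
Definition Vspace p q n : set {mpoly R[d.+1]} :=
  [set P | (exists2 Q, (msize Q <= n.+1)%N & cone_ideal (P - Q)) /\
           forall Q, (msize Q <= n)%N -> cone_inner p q P Q = 0].

Definition orthogonal_basis_Vspace p q n (I : finType)
    (b : I -> {mpoly R[d.+1]}) : Prop :=
  basis_modulo cone_ideal (Vspace p q n) b /\
  forall i j, i != j -> cone_inner p q (b i) (b j) = 0.

(* S_{n,m,l}^{p,q,M}, with Y in the role of Y_l^m *)
Definition Spoly p q n m (Y : {mpoly R[d]}) : {mpoly R[d.+1]} :=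
  horner_alg (mX ord_max : {mpoly R[d.+1]})
    (Mpoly (n - m) (p - (2 * m)%:R - d%:R + 1) (q + (2 * m)%:R + d%:R - 1))
  * mwiden Y.

Definition H_const p q m n : R :=
  let p' := p - (2 * m)%:R - d%:R + 1 in
  let q' := q + (2 * m)%:R + d%:R - 1 in
  c_const (p - d%:R + 1) (q + d%:R - 1) / c_const p' q'
  * h_const (n - m) p' q'.

End Cone.

Arguments H_const {R} d p q m n.

(* Main.v *)
(* On the cone ||x||^2 = t^2, so the decomposition F = H + ||x||^2 G with H
   harmonic turns every polynomial of degree at most n into a combination of
   terms a(t) Y(x) with Y in the basis of the harmonics of degree m and a of
   degree at most n - m.  In polar coordinates the inner product of a(t) Y(x)
   and b(t) Y'(x) is the spherical inner product of Y and Y' times the integral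
   of a b against the weight t^(q+2m+d-1) / (1+t)^(p+q), for which the
   M_k^(p-2m-d+1,q+2m+d-1) are orthogonal.

   Spherical part: on homogeneous P of degree n, the divergence theorem reads
   (n + d - 1) \int x_i P = \int d_i P; on monomials it reduces to the
   recurrences of the Wallis integrals.  With Euler's identity it makes
   deg(P) \int P Q symmetric in harmonic P and Q, so harmonics of different
   degrees are orthogonal.

   Radial part: the moments of the weight are Beta integrals.  Their recurrence
   (Pearson's equation) is integration by parts on polynomials, and moves the n
   derivatives of the Rodrigues formula onto the other factor. *)

Require Import Defs.
From mathcomp Require Import all_boot all_order all_algebra.
From mathcomp Require Import all_classical all_reals all_analysis.
From mathcomp Require Import measurable_realfun.
From mathcomp Require Import -(notations) mpoly.
From mathcomp Require Import ring lra zify.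

Set Implicit Arguments.
Unset Strict Implicit.
Unset Printing Implicit Defensive.
Import Order.TTheory GRing.Theory Num.Theory.
Import numFieldNormedType.Exports.
Local Open Scope classical_set_scope.
Local Open Scope ring_scope.

(** * Gamma and Beta integrals *)

Section ImproperIntegrals.
Context {R : realType}.
Notation mu := (@lebesgue_measure R).
Local Open Scope ereal_scope.

(** Monotone convergence along the cutoffs [c / k.+2]. The scale [c] makes the cutoffs of two
    integrals correspond under the dilation t -> c t of [eGamma_scale], whose substitution is done
    on closed half-lines away from the singularity at 0. *)
Lemma cvg_integral_itv_gt0 (b : itv_bound R) (c : R) (f : R -> \bar R) :
  (0 < c)%R -> measurable_fun setT f -> (forall x, 0 <= f x) ->
  \int[mu]_(x in [set` Interval (BLeft (c / k.+2%:R)%R) b]) f x @[k --> \oo]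
  --> \int[mu]_(x in [set` Interval (BRight 0%R) b]) f x.
Proof.
move=> c0 mf f0.
have -> : [set` Interval (BRight 0%R) b] =
    \bigcup_k [set` Interval (BLeft (c / k.+2%:R)%R) b].
  rewrite eqEsubset; split => x /=.
    rewrite in_itv /= => /andP[x0 xb].
    have [k kx] : exists k : nat, (c / x <= k.+2%:R)%R.
      exists (Num.bound (c / x)); have /ltW/le_trans := archi_boundP (ltW (divr_gt0 c0 x0)).
      by apply; rewrite ler_nat 2?leqW.
    exists k => //=; rewrite in_itv /= xb andbT.
    by rewrite ler_pdivrMr ?ltr0n// mulrC -ler_pdivrMr.
  move=> [k _] /=; rewrite !in_itv /= => /andP[kx ->]; rewrite andbT.
  by apply: lt_le_trans kx; rewrite divr_gt0 ?ltr0n.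
apply: ge0_nondecreasing_set_cvg_integral => //.
- move=> i j ij; apply/subsetPset => x /=; rewrite !in_itv /= => /andP[kx ->].
  rewrite andbT; apply: le_trans kx.
  by rewrite ler_pM2l// lef_pV2 ?posrE ?ltr0n// ler_nat.
- by move=> i; apply: measurable_funTS.
Qed.

Lemma measurable_powR_expR (a c : R) :
  measurable_fun setT (fun t : R => (t `^ a * expR (- (c * t)))%:E).
Proof.
apply/measurable_EFinP/measurable_funM; first exact: measurable_powR.
apply: measurableT_comp => //; apply: measurableT_comp => //.

Qed.

Lemma measurable_Gamma_integrand (D : set R) (a : R) :
  measurable_fun D (fun t : R => (t `^ a * expR (- t))%:E).
Proof.
apply: measurable_funTS.
by have := measurable_powR_expR a 1; under eq_fun do rewrite mul1r.
Qed.

(** Tonelli on the whole plane, applied to [f] extended by 0 outside the product of [D] and [E]. *)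
Lemma ge0_tonelli (D E : set R) (f : R -> R -> R) :
  measurable D -> measurable E ->
  measurable_fun setT (fun z : R * R => f z.1 z.2) ->
  (forall x y, (0 <= f x y)%R) ->
  \int[mu]_(x in D) \int[mu]_(y in E) (f x y)%:E =
  \int[mu]_(y in E) \int[mu]_(x in D) (f x y)%:E.
Proof.
move=> mD mE mf f0.
pose g (z : R * R) := ((fun z => (f z.1 z.2)%:E) \_ (D `*` E)) z.
have mg : measurable_fun setT g.
  apply/(measurable_restrictT _ _).1 => /=; first exact: measurableX.
  by apply: measurable_funTS; apply/measurable_EFinP.
have g0 z : 0 <= g z.
  by apply: erestrict_ge0 => ? _; rewrite lee_fin.
have := @fubini_tonelli _ _ _ _ _ mu mu g mg g0.
have gE x y : g (x, y) = if x \in D then if y \in E then (f x y)%:E else 0 else 0.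
  rewrite /g patchE; rewrite in_setX /=.
  by case: (x \in D).
have -> : (fun x => \int[mu]_y g (x, y)) = (fun x => \int[mu]_(y in E) (f x y)%:E) \_ D.
  apply/funext => x; rewrite patchE; under eq_integral do rewrite gE.
  case: (x \in D); last by rewrite integral0.
  by rewrite [RHS]integral_mkcond; apply: eq_integral => y _; rewrite patchE.
have -> : (fun y => \int[mu]_x g (x, y)) = (fun y => \int[mu]_(x in D) (f x y)%:E) \_ E.
  apply/funext => y; rewrite patchE; under eq_integral do rewrite gE.
  case: (y \in E); last by rewrite integral0_eq// => x _; case: ifP.
  by rewrite [RHS]integral_mkcond; apply: eq_integral => x _; rewrite patchE.
by rewrite -!integral_mkcond.
Qed.

End ImproperIntegrals.

(** * Extended-real Gamma and Beta integrals *)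

Section EulerIntegral.
Context {R : realType}.
Notation mu := (@lebesgue_measure R).
Local Open Scope ereal_scope.

(** Kept in the extended reals, so that Tonelli and monotone convergence apply before finiteness is
    known. *)
Definition eGamma (z : R) : \bar R :=
  \int[mu]_(t in `]0%R, +oo[) (t `^ (z - 1) * expR (- t))%:E.

Lemma eGamma_ge0 z : 0 <= eGamma z.
Proof.
apply: integral_ge0 => t _.
by rewrite lee_fin mulr_ge0 ?powR_ge0 ?expR_ge0.
Qed.

Lemma continuous_powR (a x : R) : (0 < x)%R -> {for x, continuous (fun t : R => t `^ a)%R}.
Proof.
move=> x0; apply: differentiable_continuous; apply/derivable1_diffP.
by apply: ex_derive; exact: is_derive1_powR.
Qed.

(** The substitution u = c t on [[1 / k.+2, +oo[], followed by k -> oo on both sides. *)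
Lemma eGamma_scale (z c : R) : (0 < c)%R ->
  \int[mu]_(t in `]0%R, +oo[) (t `^ (z - 1) * expR (- (c * t)))%:E =
  (c `^ (- z))%:E * eGamma z.
Proof.
move=> c0.
pose G (t : R) := (t `^ (z - 1) * expR (- t))%R.
have G0 t : (0 <= G t)%R by rewrite mulr_ge0 ?powR_ge0 ?expR_ge0.
have mG : measurable_fun setT (fun t => (G t)%:E).
  exact: measurable_Gamma_integrand.
have h1 := @cvg_integral_itv_gt0 _ (BInfty R false) c _ c0 mG G0.
have h2 := @cvg_integral_itv_gt0 _ (BInfty R false) 1%R _ ltr01
  (measurable_powR_expR (z - 1) c) (fun t => mulr_ge0 (powR_ge0 _ _) (expR_ge0 _)).
have E k : \int[mu]_(x in `[(c / k.+2%:R)%R, +oo[) (G x)%:E =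
    (c `^ z)%:E * \int[mu]_(x in `[(1 / k.+2%:R)%R, +oo[)
      (x `^ (z - 1) * expR (- (c * x)))%:E.
  have k0 : (0 < 1 / k.+2%:R :> R)%R by rewrite divr_gt0 ?ltr0n.
  have dF (x : R) : is_derive x 1%R (fun x : R => c * x)%R c.
    have := is_deriveZ (c : R) (is_derive_id x (1%R : R)).
    by rewrite /GRing.scale /= mulr1.
  have dFE : derive1 (fun x : R => c * x)%R = fun=> c.
    by apply/funext => x; rewrite derive1E; have [_ ->] := dF x.
  have -> : (c / k.+2%:R = c * (1 / k.+2%:R))%R by rewrite mul1r.
  rewrite (@increasing_ge0_integration_by_substitutiony _ (fun x => c * x)%R
    G (1 / k.+2%:R)%R); first last.
  - by move=> x _; exact: G0.
  - apply: (@continuous_in_subspaceT R^o _ `[(c * (1 / k.+2%:R))%R, +oo[ G) => x.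
    rewrite inE /= in_itv /= andbT => kx.
    have x0 : (0 < x)%R by apply: lt_le_trans kx; rewrite mulr_gt0.
    apply: (@cvgM _ _ _ _ (fun t : R => t `^ (z - 1))%R (fun t : R => expR (- t)));
      first exact: continuous_powR.
    apply: (@cvg_comp _ _ _ (fun t : R => - t)%R expR); last exact: continuous_expR.
    by apply: cvgN; exact: cvg_id.
  - exact: gt0_cvgMry.
  - split; last first.
      apply: cvg_at_right_filter; apply: cvgMr; exact: cvg_id.
    by move=> x _; case: (dF x).
  - rewrite dFE; exact: is_cvg_cst.
  - rewrite dFE; exact: is_cvg_cst.
  - by move=> x _; rewrite dFE; exact: cvg_cst.
  - by move=> x y _ _ xy; rewrite ltr_pM2l.
  rewrite -ge0_integralZl//; last 3 first.
  - by apply: measurable_funTS; exact: measurable_powR_expR.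
  - by move=> x _; rewrite lee_fin mulr_ge0 ?powR_ge0 ?expR_ge0.
  - by rewrite lee_fin powR_ge0.
  apply: eq_integral => x; rewrite inE /= in_itv /= andbT => kx.
  have x0 : (0 <= x)%R by rewrite (le_trans _ kx)// ltW.
  rewrite /= dFE -EFinM; congr EFin; rewrite /G !fctE powRM ?(ltW c0)//.
  have -> : (c `^ z = c * c `^ (z - 1))%R.
    by rewrite -{2}(powRr1 (ltW c0)) -powRD ?subrKC// (gt_eqF c0) implybT.
  ring.
have h1' : \int[mu]_(x in `[(c / k.+2%:R)%R, +oo[) (G x)%:E @[k --> \oo] -->
   (c `^ z)%:E * \int[mu]_(t in `]0%R, +oo[) (t `^ (z - 1) * expR (- (c * t)))%:E.
  under eq_cvg do rewrite E.
  exact: cvgeZl h2.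
have := cvg_unique _ h1 h1'.
rewrite -/(eGamma z) => /(_ (@ereal_hausdorff R)) ->.
by rewrite muleA -EFinM powRN mulVf ?mul1e// gt_eqF ?powR_gt0.
Qed.

(** The half-line form of the Beta integral, which has the shape of the radial weight. *)
Definition eBeta (x y : R) : \bar R :=
  \int[mu]_(t in `]0%R, +oo[) (t `^ (x - 1) / (1 + t) `^ (x + y))%:E.

Lemma measurable_betaw (a b : R) :
  measurable_fun setT (fun t : R => t `^ a / (1 + t) `^ b)%R.
Proof.
under eq_fun do rewrite -powRN.
apply: measurable_funM; first exact: measurable_powR.
by apply: (measurableT_comp (measurable_powR _)); exact: measurable_funD.
Qed.

(* Both sides are [\int\int t^(x-1) s^(x+y-1) exp(-(1+t)s) dt ds]. *)
Lemma eBetaE (x y : R) : eGamma (x + y) * eBeta x y = eGamma x * eGamma y.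
Proof.
pose f (t s : R) : R :=
  (t `^ (x - 1) * (s `^ (x + y - 1) * expR (- ((1 + t) * s))))%R.
have f0 t s : (0 <= f t s)%R by rewrite !mulr_ge0 ?powR_ge0 ?expR_ge0.
have mf : measurable_fun setT (fun z : R * R => f z.1 z.2).
  apply: measurable_funM.
    by apply: (measurableT_comp (measurable_powR _)); exact: measurable_fst.
  apply: measurable_funM.
    by apply: (measurableT_comp (measurable_powR _)); exact: measurable_snd.
  apply: measurableT_comp => //; apply: measurableT_comp => //.
  apply: measurable_funM; last exact: measurable_snd.
  by apply: measurable_funD => //; exact: measurable_fst.
have := ge0_tonelli (D := `]0%R, +oo[) (E := `]0%R, +oo[)
  (measurable_itv _) (measurable_itv _) mf f0.
have -> : \int[mu]_(t in `]0%R, +oo[) \int[mu]_(s in `]0%R, +oo[) (f t s)%:E =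
    eGamma (x + y) * eBeta x y.
  rewrite /eBeta -ge0_integralZl//; last 3 first.
  - by apply: measurable_funTS; apply/measurable_EFinP; exact: measurable_betaw.
  - by move=> t _; rewrite lee_fin divr_ge0 ?powR_ge0.
  - exact: eGamma_ge0.
  apply: eq_integral => t; rewrite inE /= in_itv /= andbT => t0.
  have t1 : (0 < 1 + t)%R by rewrite addr_gt0.
  under eq_integral do rewrite /f EFinM.
  rewrite ge0_integralZl//; last 3 first.
  - by apply: measurable_funTS; exact: measurable_powR_expR.
  - by move=> s _; rewrite lee_fin mulr_ge0 ?powR_ge0 ?expR_ge0.
  - by rewrite lee_fin powR_ge0.
  by rewrite eGamma_scale// muleA -EFinM muleC powRN.
have -> : \int[mu]_(s in `]0%R, +oo[) \int[mu]_(t in `]0%R, +oo[) (f t s)%:E =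
    eGamma x * eGamma y.
  rewrite [in RHS]/eGamma -ge0_integralZl//; last 3 first.
  - exact: measurable_Gamma_integrand.
  - by move=> t _; rewrite lee_fin mulr_ge0 ?powR_ge0 ?expR_ge0.
  - exact: eGamma_ge0.
  apply: eq_integral => s; rewrite inE /= in_itv /= andbT => s0.
  rewrite (_ : (fun t => (f t s)%:E) = fun t => (s `^ (x + y - 1) * expR (- s))%:E *
      (t `^ (x - 1) * expR (- (s * t)))%:E); last first.
    apply/funext => t; rewrite /f -EFinM; congr EFin.
    by rewrite mulrDl mul1r opprD expRD (mulrC t s); ring.
  rewrite ge0_integralZl//; last 3 first.
  - by apply: measurable_funTS; exact: measurable_powR_expR.
  - by move=> t _; rewrite lee_fin mulr_ge0 ?powR_ge0 ?expR_ge0.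
  - by rewrite lee_fin mulr_ge0 ?powR_ge0 ?expR_ge0.
  rewrite eGamma_scale// muleA -EFinM muleC; congr (_ * (_)%:E).
  rewrite -mulrA (mulrC (expR _)) mulrA -powRD ?(gt_eqF s0) ?implybT//.
  by congr (_ `^ _ * _)%R; ring.
by [].
Qed.

(** The integrand is the density of the exponential distribution of rate 1. *)
Lemma eGamma1 : eGamma 1 = 1.
Proof.
have := @integral_exponential_pdf R 1%R ltr01.
have -> : (fun t => (exponential_pdf 1 t)%:E) =
    (fun t : R => (1 * expR (- 1 * t))%:E) \_ `[0%R, +oo[.
  by apply/funext => t; rewrite /exponential_pdf !patchE; case: ifP.
rewrite -integral_mkcond -integral_itv_obnd_cbnd; last first.
  apply: measurable_funTS; apply/measurable_EFinP; apply: measurable_funM => //.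
  by apply: measurableT_comp => //; exact: measurable_funM.
move=> <-; apply: eq_integral => t _.
by rewrite subrr powRr0 !mul1r mulN1r.
Qed.

(** For x = 1 the power of t is constant and -(1+t)^(-y) / y is an antiderivative. This one value
    turns [eBetaE] into the functional equation of Gamma. *)
Lemma eBeta1 (y : R) : (0 < y)%R -> eBeta 1 y = (y^-1)%:E.
Proof.
move=> y0; rewrite /eBeta.
have dF (x : R) : (0 < 1 + x)%R ->
    is_derive x 1%R (fun t : R => - (y^-1 * (1 + t) `^ (- y)))%R ((1 + x) `^ (- (1 + y)))%R.
  move=> x0.
  have D0 : is_derive x 1%R (fun t : R => 1 + t)%R (0 + 1)%R.
    by apply: is_deriveD; exact: is_derive_cst.
  have := @is_derive1_comp _ _ _ x _ _ (is_derive1_powR (- y) x0) D0.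
  rewrite add0r mulr1 => D1.
  have := is_deriveN (is_deriveZ (y^-1)%R D1).
  rewrite /GRing.scale /= mulrA mulrN mulVf ?gt_eqF// mulN1r opprK.
  by rewrite opprD (addrC (- 1)%R).
have cf (a x : R) : (0 < 1 + x)%R -> {for x, continuous (fun t : R => (1 + t) `^ a)%R}.
  move=> x0; apply: (@cvg_comp _ _ _ (fun t : R => 1 + t)%R (fun t => t `^ _)%R).
    by apply: cvgD; [exact: cvg_cst|exact: cvg_id].
  exact: continuous_powR.
rewrite (_ : \int[mu]_(t in _) _ =
    \int[mu]_(t in `]0%R, +oo[) ((1 + t) `^ (- (1 + y)))%:E); last first.
  by apply: eq_integral => t _; rewrite subrr powRr0 mul1r powRN.
rewrite integral_itv_obnd_cbnd; last first.
  apply: measurable_funTS; apply/measurable_EFinP.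
  by apply: (measurableT_comp (measurable_powR _)); exact: measurable_funD.
rewrite (@ge0_continuous_FTC2y _ _ (fun t : R => - (y^-1 * (1 + t) `^ (- y)))%R 0%R 0%R).
- by rewrite addr0 powR1 mulr1 EFinN oppeK add0e.
- by move=> x _; exact: powR_ge0.
- apply: (@continuous_in_subspaceT R^o _ `[0%R, +oo[ (fun t : R => (1 + t) `^ (- (1 + y)))%R) => x.
  rewrite inE /= in_itv /= andbT => x0.
  by apply: cf; rewrite ltr_pwDl.
- suff h0 : ((1 + t) `^ (- y))%R @[t --> +oo%R] --> 0%R.
    have : (y^-1 * (1 + t) `^ (- y))%R @[t --> +oo%R] --> (y^-1 * 0)%R by apply: cvgMr.
    by move/cvgN; rewrite mulr0 oppr0.
  have h : (fun t : R => y * ln (1 + t))%R @ +oo%R --> +oo%R.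
    apply/cvgryPge => A; near=> t.
    rewrite mulrC -ler_pdivrMr// -ler_expR lnK.
      by rewrite ler_wpDl//; near: t; apply: nbhs_pinfty_ge; exact: num_real.
    rewrite posrE addr_gt0//; near: t; apply: nbhs_pinfty_gt; exact: num_real.
  have := cvg_comp _ _ h (@cvgr_expR R).
  apply: cvg_trans; apply: near_eq_cvg; near=> t.
  rewrite /= /powR gt_eqF ?mulNr// addr_gt0//.
- by move=> x x0; case: (dF x (addr_gt0 ltr01 x0)).
- by apply: cvg_at_right_filter; apply: cvgN; apply: cvgMr; apply: cf; rewrite addr0.
- move=> x; rewrite in_itv /= andbT => x0.
  by rewrite derive1E; case: (dF x (addr_gt0 ltr01 x0)).
Unshelve. all: by end_near.
Qed.

Lemma eGammaS (z : R) : (0 < z)%R -> eGamma (z + 1) = z%:E * eGamma z.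
Proof.
move=> z0; have := eBetaE 1 z; rewrite eGamma1 mul1e eBeta1// => <-.
by rewrite addrC muleC -muleA -EFinM mulVf ?gt_eqF// mule1.
Qed.

Lemma eGamma_natS (n : nat) : eGamma n.+1%:R = n`!%:R%:E.
Proof.
elim: n => [|n IH]; first exact: eGamma1.
by rewrite -natr1 eGammaS ?ltr0n// IH -EFinM -natrM factS.
Qed.

(** For z >= 1, t^(z-1) <= 1 + t^n with n a natural number above z - 1, which bounds the integral by
    Gamma(1) + n!. The functional equation carries finiteness down to 0 < z < 1. *)
Lemma eGamma_lty (z : R) : (0 < z)%R -> eGamma z < +oo.
Proof.
have ge1 (x : R) : (1 <= x)%R -> eGamma x < +oo.
  move=> x1; pose n := Num.bound x.
  have xn : (x - 1 <= n%:R)%R.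
    rewrite (le_trans _ (ltW (archi_boundP (le_trans ler01 x1))))//.
    by rewrite gerBl.
  apply: (@le_lt_trans _ _ (eGamma 1 + eGamma n.+1%:R)); last first.
    by rewrite eGamma1 eGamma_natS -EFinD ltry.
  have mG := @measurable_Gamma_integrand R `]0%R, +oo[.
  have G0 a (t : R) : 0 <= (t `^ a * expR (- t))%:E.
    by rewrite lee_fin mulr_ge0 ?powR_ge0 ?expR_ge0.
  rewrite /eGamma -ge0_integralD//; [|exact: mG..].
  apply: ge0_le_integral => //.
  - exact: mG.
  - by apply: emeasurable_funD; exact: mG.
  move=> t; rewrite /= in_itv /= andbT => t0.
  rewrite -EFinD lee_fin -mulrDl ler_wpM2r ?expR_ge0// subrr powRr0.
  have [t1|t1] := leP t 1%R.
    rewrite ler_wpDr ?powR_ge0//.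
    by rewrite -[leRHS](powRr0 t) ger_powR ?t0// subr_ge0.
  rewrite ler_wpDl//; apply: ler_powR; first exact: ltW.
  by rewrite -natr1 addrK.
move=> z0; have [z1|z1] := leP 1%R z; first exact: ge1.
have := ge1 (z + 1)%R; rewrite lerDr => /(_ (ltW z0)); rewrite eGammaS//.
by apply: contraTT; rewrite -!leNgt !leye_eq => /eqP ->; rewrite gt0_muley ?lte_fin.
Qed.

(** For z >= 1 the integrand is at least exp(-2) on [1, 2]; smaller z follow from the functional
    equation. *)
Lemma eGamma_gt0 (z : R) : (0 < z)%R -> 0 < eGamma z.
Proof.
have ge1 (x : R) : (1 <= x)%R -> 0 < eGamma x.
  move=> x1.
  have mG D := @measurable_Gamma_integrand R D (x - 1).
  apply: (@lt_le_trans _ _ (\int[mu]_(t in `[1%R, 2%R]) (expR (- 2))%:E)).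
    rewrite integral_cst//= lebesgue_measure_itv /= lte_fin ltr1n.
    by rewrite mule_gt0 ?lte_fin ?expR_gt0 ?subr_gt0 ?ltr1n.
  apply: (@le_trans _ _ (\int[mu]_(t in `[1%R, 2%R]) (t `^ (x - 1) * expR (- t))%:E)).
    apply: ge0_le_integral => //.
    - exact: mG.
    - move=> t; rewrite /= in_itv /= => /andP[t1 t2].
      rewrite lee_fin -[leLHS]mul1r ler_pM ?expR_ge0//.
        by rewrite -[leLHS](powRr0 t) ler_powR// subr_ge0.
      by rewrite ler_expR lerN2.
  apply: ge0_subset_integral => //.
  - exact: mG.
  - by move=> t _; rewrite lee_fin mulr_ge0 ?powR_ge0 ?expR_ge0.
  - move=> t; rewrite /= !in_itv /= andbT => /andP[t1 _].
    exact: lt_le_trans t1.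
move=> z0; have [z1|z1] := leP 1%R z; first exact: ge1.
have := ge1 (z + 1)%R; rewrite lerDr => /(_ (ltW z0)); rewrite eGammaS//.
apply: contraTT; rewrite -!leNgt => h.
by rewrite mule_ge0_le0 ?lee_fin// ltW.
Qed.

End EulerIntegral.

(** * The real-valued Gamma function *)

Section Gamma.
Context {R : realType}.
Implicit Types x y z : R.

Lemma eGamma_fin_num z : 0 < z -> eGamma z \is a fin_num.
Proof. by move=> z0; rewrite ge0_fin_numE ?eGamma_lty ?eGamma_ge0. Qed.

Lemma GammaE z : 0 < z -> (Gamma z)%:E = eGamma z.
Proof. by move=> z0; rewrite /Gamma /Rintegral fineK// eGamma_fin_num. Qed.

Lemma Gamma_gt0 z : 0 < z -> 0 < Gamma z.
Proof. by move=> z0; rewrite -lte_fin GammaE// eGamma_gt0. Qed.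

Lemma GammaS z : 0 < z -> Gamma (z + 1) = z * Gamma z.
Proof.
by move=> z0; apply: EFin_inj; rewrite EFinM !GammaE ?eGammaS ?addr_gt0.
Qed.

Definition Beta x y := Gamma x * Gamma y / Gamma (x + y).

Lemma eBeta_Beta x y : 0 < x -> 0 < y -> eBeta x y = (Beta x y)%:E.
Proof.
move=> x0 y0; have xy0 : 0 < x + y by rewrite addr_gt0.
rewrite /Beta EFinM [(Gamma x * _)%:E]EFinM !GammaE// -eBetaE -GammaE//.
by rewrite [((Gamma (x + y))%:E * _)%E]muleC -muleA -EFinM mulfV ?mule1// gt_eqF// Gamma_gt0.
Qed.

End Gamma.

(** * Moments of the radial weight *)

(* Keeps unification from unfolding the integrals. *)
Local Opaque Gamma eBeta eGamma.

Section Moments.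
Context {R : realType}.
Notation mu := (@lebesgue_measure R).
Implicit Types (p q a b : R) (P Q F G H : {poly R}) (n k : nat).

Lemma Gamma_rising (z : R) n : 0 < z -> Gamma (z + n%:R) = rising z n * Gamma z.
Proof.
move=> z0; rewrite /rising; elim: n => [|n IH].
  by rewrite addr0 big_ord0 mul1r.
rewrite -natr1 addrA GammaS; last by rewrite ltr_wpDr.
by rewrite IH big_ord_recr /= mulrA [_ * (z + _)]mulrC.
Qed.

(** The Beta value B(q+k+1, p-1-k), which is the k-th moment of the weight when -1 < q and k < p -
    1. *)
Definition moment p q k : R :=
  Gamma (q + k%:R + 1) * Gamma (p - 1 - k%:R) / Gamma (p + q).

(** A factor t^j of the integrand is absorbed by the weight: q grows by j and p drops by j, as p + q
    is the exponent of 1 + t. *)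
Lemma moment_shift p q k j : moment p q (k + j) = moment (p - j%:R) (q + j%:R) k.
Proof.
rewrite /moment natrD.
have -> : q + (k%:R + j%:R) + 1 = q + j%:R + k%:R + 1 by ring.
have -> : p - 1 - (k%:R + j%:R) = p - j%:R - 1 - k%:R by ring.
by have -> : p + q = p - j%:R + (q + j%:R) by ring.
Qed.

Lemma weightE p q k (t : R) : 0 < t ->
  t ^+ k * weight p q t = t `^ (q + k%:R) / (1 + t) `^ (p + q).
Proof.
move=> t0; rewrite /weight mulrA -powR_mulrn ?ltW// -powRD ?(gt_eqF t0) ?implybT//.
by rewrite addrC.
Qed.

Lemma integral_moment p q k : -1 < q -> k%:R < p - 1 ->
  (\int[mu]_(t in `]0%R, +oo[) (t ^+ k * weight p q t)%:E = (moment p q k)%:E)%E.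
Proof.
move=> q1 kp.
transitivity (eBeta (q + k%:R + 1) (p - 1 - k%:R)).
  apply: eq_integral => t; rewrite inE /= in_itv /= andbT => t0.
  rewrite weightE// addrK; congr (_ / _ `^ _)%:E; ring.
have h1 : 0 < q + k%:R + 1 by rewrite -ltrBlDr sub0r ltr_wpDr.
have h2 : 0 < p - 1 - k%:R by rewrite subr_gt0.
rewrite (eBeta_Beta h1 h2).
by rewrite /Beta /moment; have -> : q + k%:R + 1 + (p - 1 - k%:R) = p + q by ring.
Qed.

Lemma measurable_weight p q : measurable_fun setT (weight p q).
Proof. exact: measurable_betaw. Qed.

Lemma integrable_moment p q k : -1 < q -> k%:R < p - 1 ->
  mu.-integrable `]0, +oo[ (EFin \o (fun t => t ^+ k * weight p q t)).
Proof.
move=> q1 kp; apply/integrableP; split.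
  apply: measurable_funTS; apply/measurable_EFinP.
  by apply: measurable_funM; [exact: measurable_funX|exact: measurable_weight].
rewrite (_ : (\int[mu]_(x in _) _)%E =
    (\int[mu]_(t in `]0%R, +oo[) (t ^+ k * weight p q t)%:E)%E).
  by rewrite integral_moment// ltry.
apply: eq_integral => t; rewrite inE /= in_itv /= andbT => t0.
rewrite ger0_norm// mulr_ge0 ?exprn_ge0 ?(ltW t0)//.
by rewrite /weight divr_ge0 ?powR_ge0.
Qed.

(** An algebraic stand-in for the integral of P against the weight: it is linear in P without
    integrability hypotheses, and [integral_moment_fun] identifies it with the integral. *)
Definition moment_fun p q P : R := \sum_(k < size P) P`_k * moment p q k.

Lemma moment_fun_widen n p q P : (size P <= n)%N ->
  moment_fun p q P = \sum_(k < n) P`_k * moment p q k.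
Proof.
move=> Pn; rewrite /moment_fun (big_ord_widen n (fun k => P`_k * moment p q k) Pn) big_mkcond.
apply: eq_bigr => k _; case: ltnP => // Pk.
by rewrite nth_default// mul0r.
Qed.

Lemma moment_funD p q P Q : moment_fun p q (P + Q) = moment_fun p q P + moment_fun p q Q.
Proof.
rewrite !(@moment_fun_widen (maxn (size P) (size Q))) ?leq_maxl ?leq_maxr ?size_polyD//.
by rewrite -big_split /=; apply: eq_bigr => k _; rewrite coefD mulrDl.
Qed.

Lemma moment_funZ p q (c : R) P : moment_fun p q (c *: P) = c * moment_fun p q P.
Proof.
rewrite !(@moment_fun_widen (size P)) ?size_scale_leq// mulr_sumr.
by apply: eq_bigr => k _; rewrite coefZ -mulrA.
Qed.

Lemma moment_fun0 p q : moment_fun p q 0 = 0.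
Proof. by rewrite -(scale0r 0) moment_funZ mul0r. Qed.

Lemma moment_funN p q P : moment_fun p q (- P) = - moment_fun p q P.
Proof. by rewrite -scaleN1r moment_funZ mulN1r. Qed.

Lemma moment_fun_sum p q (I : Type) (r : seq I) (A : pred I) (f : I -> {poly R}) :
  moment_fun p q (\sum_(i <- r | A i) f i) = \sum_(i <- r | A i) moment_fun p q (f i).
Proof. by apply: (big_morph (moment_fun p q)); [exact: moment_funD|exact: moment_fun0]. Qed.

Lemma moment_funXn p q k : moment_fun p q 'X^k = moment p q k.
Proof.
rewrite (@moment_fun_widen k.+1) ?size_polyXn// (bigD1 ord_max)//= coefXn eqxx mul1r.
by rewrite big1 ?addr0// => i ik; rewrite coefXn -val_eqE /= in ik *; rewrite (negbTE ik) mul0r.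
Qed.

Lemma moment_funC p q c : moment_fun p q c%:P = c * moment p q 0.
Proof. by rewrite -[c%:P]mulr1 mul_polyC moment_funZ -(moment_funXn p q 0) expr0. Qed.

Lemma moment_fun_mulXn p q j P :
  moment_fun p q ('X^j * P) = moment_fun (p - j%:R) (q + j%:R) P.
Proof.
rewrite -[in LHS](coefK P) poly_def mulr_sumr moment_fun_sum; apply: eq_bigr => k _.
by rewrite -scalerAr -exprD addnC moment_funZ moment_funXn moment_shift.
Qed.

Lemma integral_moment_fun p q P : -1 < q -> (size P)%:R < p ->
  mu.-integrable `]0, +oo[ (EFin \o (fun t => P.[t] * weight p q t)) /\
  \int[mu]_(t in `]0, +oo[) (P.[t] * weight p q t) = moment_fun p q P.
Proof.
move=> q1 Pp.
have [E kp] : (fun t => P.[t] * weight p q t) =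
    (fun t => \sum_(k < size P) P`_k * (t ^+ k * weight p q t)) /\
    forall k : 'I_(size P), k%:R < p - 1.
  split.
    apply/funext => t; rewrite horner_coef mulr_suml.
    by apply: eq_bigr => k _; rewrite mulrA.
  move=> k; rewrite ltrBrDr; apply: le_lt_trans Pp.
  by rewrite natr1 ler_nat.
rewrite E /moment_fun; elim: (index_enum _) => [|k s [IH1 IH2]].
  split.
    rewrite (_ : _ \o _ = cst 0%E); first exact: integrable0.
    by apply/funext => t; rewrite /= big_nil.
  under eq_Rintegral do rewrite big_nil.
  by rewrite big_nil /Rintegral integral0.
have i1 : mu.-integrable `]0, +oo[
    (EFin \o (fun t => P`_k * (t ^+ k * weight p q t))).
  have := @integrableZl _ _ _ mu `]0, +oo[ (measurable_itv _) (P`_k) _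
    (@integrable_moment p q k q1 (kp k)).
  by apply: eq_integrable => // t _; rewrite /= EFinM.
have EE : (fun t => \sum_(j <- k :: s) P`_j * (t ^+ j * weight p q t)) =
   (fun t => P`_k * (t ^+ k * weight p q t) +
             \sum_(j <- s) P`_j * (t ^+ j * weight p q t)).
  by apply/funext => t; rewrite big_cons.
split.
  rewrite EE; have := @integrableD _ _ _ mu `]0, +oo[ (measurable_itv _) _ _ i1 IH1.
  by apply: eq_integrable => // t _; rewrite /= EFinD.
rewrite EE RintegralD// IH2 big_cons RintegralZl//; last exact: integrable_moment.
by rewrite /Rintegral integral_moment.
Qed.

Lemma momentS p q k : -1 < q -> k.+1%:R < p - 1 ->
  (p - k%:R - 2) * moment p q k.+1 = (q + k%:R + 1) * moment p q k.
Proof.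
move=> q1 kp.
have h1 : 0 < q + k%:R + 1 by rewrite -ltrBlDr sub0r ltr_wpDr.
have h2 : 0 < p - 1 - k.+1%:R by rewrite subr_gt0.
rewrite /moment.
have -> : q + k.+1%:R + 1 = (q + k%:R + 1) + 1 by rewrite -(natr1 k); ring.
have -> : p - 1 - k%:R = (p - 1 - k.+1%:R) + 1 by rewrite -(natr1 k); ring.
by rewrite (GammaS h1) (GammaS h2) -(natr1 k); ring.
Qed.

(** With w the weight, (t(1+t) w)' = ((q+1) + (2-p) t) w, so the polynomial times w is the
    derivative of t(1+t) w F, whose boundary terms vanish. On monomials this is the recurrence
    [momentS], and linearity does the rest. *)
Lemma moment_fun_pearson p q F n : -1 < q -> (size F <= n)%N -> n%:R < p - 1 ->
  moment_fun p q (((q + 1)%:P + (2 - p) *: 'X) * F + 'X * (1 + 'X) * deriv F) = 0.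
Proof.
move=> q1 Fn np.
have -> : ((q + 1)%:P + (2 - p) *: 'X) * F + 'X * (1 + 'X) * deriv F =
   \sum_(k < size F) F`_k *: ((q + 1 + k%:R)%:P * 'X^k + (2 - p + k%:R)%:P * 'X^(k.+1)).
  rewrite -{1 2}(coefK F) poly_def mulr_sumr raddf_sum mulr_sumr -big_split /=.
  apply: eq_bigr => k _; rewrite derivZ derivXn -!scalerAr -scalerDr; congr (_ *: _).
  (* The constant monomial is separate because the exponent of its derivative is truncated at 0. *)
  case: (k : nat) => [|j].
    by rewrite !mulr0n mulr0 !addr0 expr0 expr1 !mulr1 -mul_polyC.
  rewrite -mulr_natl /= !exprS -!mul_polyC !rmorphD /= !rmorph_nat.
  ring.
rewrite moment_fun_sum big1// => k _.
rewrite moment_funZ moment_funD !mul_polyC !moment_funZ !moment_funXn.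
have kp : k.+1%:R < p - 1 by apply: le_lt_trans np; rewrite ler_nat (leq_trans _ Fn).
have := momentS q1 kp => e.
rewrite [X in _ * X](_ : _ = (q + k%:R + 1) * moment p q k - (p - k%:R - 2) * moment p q k.+1).
  by rewrite e subrr mulr0.
ring.
Qed.

(** t(1+t) times the weight for (p, q) is the weight for (p-2, q+1). The extra factor 1 + t changes
    p + q, so the recurrences of Gamma are needed here, unlike in [moment_fun_mulXn]. *)
Lemma moment_fun_mulX1X p q F : -1 < q -> (size F).+1%:R < p - 1 ->
  moment_fun p q ('X * (1 + 'X) * F) = moment_fun (p - 2) (q + 1) F.
Proof.
move=> q1 Fp.
rewrite -mulrA -['X]expr1 moment_fun_mulXn expr1.
rewrite -[in LHS](coefK F) poly_def mulr_sumr moment_fun_sum; apply: eq_bigr => k _.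
rewrite -scalerAr moment_funZ mulrDl mul1r -exprS moment_funD !moment_funXn; congr (_ * _).
have h1 : 0 < q + k%:R + 1 + 1 by rewrite ltr_wpDr// -ltrBlDr sub0r ltr_wpDr.
have h2 : 0 < p - 3 - k%:R.
  rewrite -addrA -opprD subr_gt0 addrC -ltrBrDr; apply: le_lt_trans (_ : (size F).+1%:R - 2 < _).
    by rewrite lerBrDr -!natrD ler_nat addn2 ltnS.
  lra.
have h3 : 0 < p + q - 1 by lra.
rewrite /moment.
have -> : q + 1 + k.+1%:R + 1 = (q + k%:R + 1 + 1) + 1 by rewrite -(natr1 k); ring.
have -> : p - 1 - 1 - k%:R = (p - 3 - k%:R) + 1 by ring.
have -> : p - 1 - 1 - k.+1%:R = p - 3 - k%:R by rewrite -(natr1 k); ring.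
have -> : p - 1 + (q + 1) = (p + q - 1) + 1 by ring.
rewrite (GammaS h1) (GammaS h2) (GammaS h3).
have -> : p - 2 - 1 - k%:R = p - 3 - k%:R by ring.
have -> : p - 2 + (q + 1) = p + q - 1 by ring.
have -> : q + 1 + k%:R + 1 = q + k%:R + 1 + 1 by ring.
have g3 : Gamma (p + q - 1) != 0 by rewrite gt_eqF ?Gamma_gt0.
have n3 : p + q - 1 != 0 by rewrite gt_eqF.
move: (Gamma _) (Gamma _) (Gamma _) g3 => g1 g2 g3 g30.
by field; rewrite g30 n3.
Qed.

End Moments.

(** * Rodrigues polynomials *)

Section Rodrigues.
Context {R : realType}.
Implicit Types (p q a b : R) (P Q F G H : {poly R}) (n k : nat).

(* [(x^a (1+x)^b)^(k) = x^(a-k) (1+x)^(b-k) (rodrigues_poly a b k).[x]] for x > 0. *)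
Fixpoint rodrigues_poly a b k : {poly R} :=
  if k is j.+1 then
    ((a - j%:R) *: (1 + 'X) + (b - j%:R) *: 'X) * rodrigues_poly a b j
    + 'X * (1 + 'X) * deriv (rodrigues_poly a b j)
  else 1.

Lemma rodrigues_polyS a b k : rodrigues_poly a b k.+1 =
  ((a - k%:R) *: (1 + 'X) + (b - k%:R) *: 'X) * rodrigues_poly a b k
  + 'X * (1 + 'X) * deriv (rodrigues_poly a b k).
Proof. by []. Qed.

Lemma derive1n_rodrigues_poly a b k (x : R) : 0 < x ->
  derive1n k (fun y : R => y `^ a * (1 + y) `^ b) x =
  x `^ (a - k%:R) * (1 + x) `^ (b - k%:R) * (rodrigues_poly a b k).[x].
Proof.
elim: k x => [|k IH] x x0; first by rewrite /derive1n /= !subr0 hornerE mulr1.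
have x1 : 0 < 1 + x by rewrite addr_gt0.
rewrite derive1nS derive1E.
rewrite (@near_eq_derive _ _ _ _
  (fun y => y `^ (a - k%:R) * (1 + y) `^ (b - k%:R) * (rodrigues_poly a b k).[y])); last first.
  by near=> y; apply: IH; near: y; exact: lt_nbhsr.
set a' := a - k%:R; set b' := b - k%:R.
have D2 : is_derive x (1 : R) (fun y : R => (1 + y) `^ b') (b' * (1 + x) `^ (b' - 1)).
  have D0 : is_derive x (1 : R) (fun y : R => 1 + y) (0 + 1).
    by apply: is_deriveD; exact: is_derive_cst.
  have := @is_derive1_comp _ _ _ x _ _ (is_derive1_powR b' x1) D0.
  by rewrite add0r mulr1.
have D3 : is_derive x (1 : R) (horner (rodrigues_poly a b k)) (deriv (rodrigues_poly a b k)).[x].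
  by apply: DeriveDef; [exact: derivable_horner|rewrite -derive1E derivE].
have [_ ->] := is_deriveM (is_deriveM (is_derive1_powR a' x0) D2) D3.
have powS (c y : R) : 0 < y -> y `^ c = y * y `^ (c - 1).
  by move=> y0; rewrite -{2}(powRr1 (ltW y0)) -powRD ?subrKC// (gt_eqF y0) implybT.
rewrite [X in X *: _ + _](_ : _ = x `^ a' * (1 + x) `^ b')//.
rewrite rodrigues_polyS -natr1 !opprD !addrA -/a' -/b' (powS a' x)// (powS b' (1 + x))// !hornerE.
rewrite -/a' -/b' /GRing.scale /=; ring.
Unshelve. all: by end_near.
Qed.

(** The difference vanishes at the positive integers up to its size, more points than its degree
    allows. *)
Lemma poly_eq_gt0 P Q : (forall x : R, 0 < x -> P.[x] = Q.[x]) -> P = Q.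
Proof.
move=> PQ; apply/eqP; rewrite -subr_eq0; apply/eqP.
apply: (@roots_geq_poly_eq0 _ _ [seq k.+1%:R | k <- iota 0 (size (P - Q))]).
- apply/allP => _ /mapP[k _ ->].
  by rewrite /root hornerD hornerN PQ ?ltr0n// subrr.
- rewrite map_inj_uniq ?iota_uniq// => i j /eqP.
  by rewrite eqr_nat => /eqP[].
- by rewrite size_map size_iota.
Qed.

(** The powers left by differentiation cancel the prefactor of the Rodrigues formula for x > 0. This
    replaces the choice in [Mpoly] by a recursion. *)
Lemma MpolyE n p q : Mpoly n p q = (-1) ^+ n *: rodrigues_poly (n%:R + q) (n%:R - p - q) n.
Proof.
apply: poly_eq_gt0 => x x0; rewrite Mpoly_rodrigues// /rodrigues derive1n_rodrigues_poly//.
have -> : n%:R + q - n%:R = q by ring.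
have -> : n%:R - p - q - n%:R = - (p + q) by ring.
rewrite powRN hornerZ.
have xq : x `^ q != 0 by rewrite gt_eqF// powR_gt0.
have xp : (1 + x) `^ (p + q) != 0 by rewrite gt_eqF//; apply: powR_gt0; rewrite addr_gt0.
by field; rewrite xq xp.
Qed.

Lemma leq_size_polyM P Q m n :
  (size P <= m.+1)%N -> (size Q <= n)%N -> (size (P * Q)%R <= m + n)%N.
Proof.
move=> Pm Qn; apply: leq_trans (size_polyMleq _ _) _.
by rewrite -[(m + n)%N]/(m.+1 + n).-1 -!subn1 leq_sub2r// leq_add.
Qed.

Lemma leq_size_deriv P n : (size P <= n.+1)%N -> (size (deriv P) <= n)%N.
Proof. by move=> Pn; apply: leq_trans (size_poly _ _) _; case: (size P) Pn. Qed.

Lemma size_rodrigues_poly a b k : (size (rodrigues_poly a b k) <= k.+1)%N.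
Proof.
elim: k => [|k IH]; first by rewrite size_poly1.
have s1 : (size (1 + 'X : {poly R})%R <= 2)%N by rewrite addrC size_XaddC.
rewrite /= (leq_trans (size_polyD _ _))// geq_max; apply/andP; split.
  apply: (@leq_size_polyM _ _ 1) => //.
  rewrite (leq_trans (size_polyD _ _))// geq_max (leq_trans (size_scale_leq _ _))//.
  by rewrite (leq_trans (size_scale_leq _ _)) ?size_polyX.
apply: (@leq_size_polyM _ _ 2); last exact: leq_size_deriv.
by apply: (@leq_size_polyM _ _ 1); rewrite ?size_polyX.
Qed.

(** Step k multiplies the top coefficient by (a-k) + (b-k) from the linear factor plus k from the
    derivative, that is by a + b - k. *)
Lemma coef_rodrigues_poly a b k : (rodrigues_poly a b k)`_k = \prod_(i < k) (a + b - i%:R).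
Proof.
elim: k => [|k IH]; first by rewrite big_ord0 coefC.
rewrite big_ord_recr /= -IH.
have h : (rodrigues_poly a b k)`_k.+1 = 0 by rewrite nth_default ?size_rodrigues_poly.
rewrite coefD mulrDl -!scalerAl mulrDl mul1r mulrDr mulr1 mulrDl -mulrA.
rewrite !(coefD, coefZ, coefXM) /= !coef_deriv h mul0rn add0r add0r.
case: (k : nat) => [|j] /=; first ring.
by rewrite -mulr_natr; ring.
Qed.

(** These parameters make the weight t^(a-k) (1+t)^(b-k), so that applying the functional to
    [rodrigues_poly a b k * G] stands for integrating the k-th derivative of t^a (1+t)^b against
    G. *)
Local Notation moment_funl a b k := (moment_fun (k%:R *+ 2 - a - b) (a - k%:R)).

(** One integration by parts: Pearson's equation for [rodrigues_poly a b k * G]. *)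
Lemma moment_fun_rodrigues_polyS a b k G : a + b < -1 -> k.+1%:R < a + 1 -> (size G <= k.+2)%N ->
  moment_funl a b k.+1 (rodrigues_poly a b k.+1 * G) = - moment_funl a b k (rodrigues_poly a b k * deriv G).
Proof.
move=> ab ka Gk.
set p : R := k.+1%:R *+ 2 - a - b; set q : R := a - k.+1%:R.
have q1 : -1 < q by rewrite /q; lra.
have sF : (size (rodrigues_poly a b k * G)%R <= k.+1.*2)%N.
  rewrite -addnn addSn -addnS; apply: leq_size_polyM => //; exact: size_rodrigues_poly.
(* This is where a + b < -1 enters: p - 1 = 2(k+1) - (a+b) - 1. *)
have p1 : k.+1.*2%:R < p - 1.
  by rewrite /p -muln2 natrM mulr_natr; lra.
have := moment_fun_pearson q1 sF p1.
(* For these p and q the Pearson factor is the linear factor in the recursion of [rodrigues_poly];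
   the product rule leaves the term with the derivative of G. *)
have -> : ((q + 1)%:P + (2 - p) *: 'X) * (rodrigues_poly a b k * G)
     + 'X * (1 + 'X) * deriv (rodrigues_poly a b k * G)
   = rodrigues_poly a b k.+1 * G + 'X * (1 + 'X) * (rodrigues_poly a b k * deriv G).
  rewrite derivM /= -!mul_polyC /q /p -(natr1 k) !(rmorphD, rmorphN, rmorphMn, rmorph_nat) /=.
  ring.
rewrite moment_funD moment_fun_mulX1X//; last first.
  apply: le_lt_trans p1; rewrite ler_nat -addnn addSn ltnS.
  by apply: leq_size_polyM; [exact: size_rodrigues_poly|exact: leq_size_deriv].
have -> : p - 2 = k%:R *+ 2 - a - b by rewrite /p -(natr1 k); ring.
have -> : q + 1 = a - k%:R by rewrite /q -(natr1 k); ring.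
by move/eqP; rewrite addr_eq0 => /eqP.
Qed.

Lemma moment_fun_rodrigues_poly a b k G : a + b < -1 -> k%:R < a + 1 -> (size G <= k.+1)%N ->
  moment_funl a b k (rodrigues_poly a b k * G) = (-1) ^+ k * moment_fun (- a - b) a (derivn k G).
Proof.
elim: k G => [|k IH] G ab ka Gk.
  by rewrite mul1r expr0 mul1r mul0rn sub0r subr0.
rewrite (moment_fun_rodrigues_polyS ab ka Gk) (IH (deriv G) ab).
- by rewrite exprS derivSn; ring.
- by move: ka; rewrite -natr1; lra.
- exact: leq_size_deriv.
Qed.

Lemma derivn_size_leq G n : (size G <= n.+1)%N -> derivn n G = (n`!%:R * G`_n)%:P.
Proof.
move=> Gn; apply/polyP => i; rewrite coef_derivn coefC.
case: i => [|i]; last by rewrite nth_default ?mul0rn// (leq_trans Gn)// addnS ltnS leq_addr.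
by rewrite addn0 ffactnn mulr_natl.
Qed.

(** After n integrations by parts G has become the constant n! G_n, and the remaining weight t^(q+n)
    (1+t)^(n-p-q) has the last factor as its mass. Orthogonality is the case G_n = 0, the norm the
    case G = M_n. *)
Lemma moment_fun_Mpoly n p q G : (2 * n)%:R + 1 < p -> -1 < q -> (size G <= n.+1)%N ->
  moment_fun p q (Mpoly n p q * G) =
  n`!%:R * G`_n * moment (p - (2 * n)%:R) (q + n%:R) 0.
Proof.
move=> np q1 Gn; rewrite MpolyE -scalerAl moment_funZ.
have := @moment_fun_rodrigues_poly (n%:R + q) (n%:R - p - q) n G.
have -> : n%:R *+ 2 - (n%:R + q) - (n%:R - p - q) = p by ring.
have -> : n%:R + q - n%:R = q by ring.
move=> ->; last by [].
- rewrite mulrA -expr2 sqrr_sign mul1r derivn_size_leq// moment_funC.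
  have -> : - (n%:R + q) - (n%:R - p - q) = p - (2 * n)%:R by rewrite natrM; ring.
  by rewrite [n%:R + q]addrC.
- by move: np; rewrite natrM; lra.
- by lra.
Qed.

Lemma size_Mpoly n p q : (size (Mpoly n p q) <= n.+1)%N.
Proof. by rewrite MpolyE (leq_trans (size_scale_leq _ _))// size_rodrigues_poly. Qed.

Lemma coef_Mpoly n p q : (Mpoly n p q)`_n = rising (p - (2 * n)%:R) n.
Proof.
rewrite MpolyE coefZ coef_rodrigues_poly /rising.
(* Each factor of the top coefficient is -(p - 2n + i); the n signs cancel the (-1)^n of
   [MpolyE]. *)
rewrite (eq_bigr (fun i : 'I_n => -1 * (p - (2 * n)%:R + i%:R))); last first.
  by move=> i _; rewrite natrM; ring.
rewrite big_split /= prodr_const card_ord mulrA -expr2 sqrr_sign mul1r.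
by [].
Qed.

Lemma rising_gt0 (z : R) n : 0 < z -> 0 < rising z n.
Proof. by move=> z0; apply: prodr_gt0 => i _; rewrite ltr_wpDr. Qed.

Definition Mnorm n p q : R := moment_fun p q (Mpoly n p q * Mpoly n p q).

Lemma MnormE n p q : (2 * n)%:R + 1 < p -> -1 < q ->
  c_const p q * Mnorm n p q = h_const n p q.
Proof.
move=> np q1; rewrite /Mnorm moment_fun_Mpoly ?size_Mpoly// coef_Mpoly.
have n0 : 0 <= n%:R :> R by [].
rewrite natrM in np *.
set u := p - 2 * n%:R - 1.
have u0 : 0 < u by rewrite /u; lra.
have q0 : 0 < q + 1 by lra.
rewrite /c_const /h_const /Gfact /moment.
have -> : p - n%:R - 1 + 1 = (u + 1) + n%:R by rewrite /u; ring.
have -> : p - 2 * n%:R = u + 1 by rewrite /u; ring.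
have -> : q + n%:R + 0 + 1 = (q + 1) + n%:R by ring.
have -> : u + 1 - 1 - 0 = u by ring.
have -> : u + 1 + (q + n%:R) = p + q - n%:R by rewrite /u; ring.
have -> : p + q - 1 + 1 = p + q by ring.
have -> : p - 2 + 1 = p - 1 by ring.
have -> : p + q - n%:R - 1 + 1 = p + q - n%:R by ring.
(* The shifted Gamma values are brought down to the arguments q + 1 and u. The denominator p - 2n -
   1 = u of [h_const] cancels the u of Gamma(u+1) = u Gamma(u). *)
rewrite (Gamma_rising n q0) (Gamma_rising n (addr_gt0 u0 ltr01)) (GammaS u0) natrM -/u.
have g1 : Gamma (p - 1) != 0 by rewrite gt_eqF// Gamma_gt0//; lra.
have g2 : Gamma (p + q - n%:R) != 0 by rewrite gt_eqF// Gamma_gt0//; lra.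
have g3 : Gamma (q + 1) != 0 by rewrite gt_eqF// Gamma_gt0.
have u1 : u != 0 by rewrite gt_eqF.
move: (Gamma _) (Gamma _) (Gamma _) (Gamma _) (Gamma _) (rising _ _) (rising _ _) g1 g2 g3.
move=> x1 x2 x3 x4 x5 r1 r2 g1 g2 g3.
by field; rewrite ?g1 ?g2 ?g3 ?u1.
Qed.

Lemma Mnorm_gt0 n p q : (2 * n)%:R + 1 < p -> -1 < q -> 0 < Mnorm n p q.
Proof.
move=> np q1; rewrite /Mnorm moment_fun_Mpoly ?size_Mpoly// coef_Mpoly /moment addr0 subr0.
have n0 : 0 <= n%:R :> R by [].
rewrite natrM in np *.
by rewrite !mulr_gt0 ?invr_gt0 ?ltr0n ?fact_gt0 ?rising_gt0 ?Gamma_gt0//; lra.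
Qed.

Lemma Mpoly_orthogonal n p q G : (2 * n)%:R + 1 < p -> -1 < q -> (size G <= n)%N ->
  moment_fun p q (Mpoly n p q * G) = 0.
Proof.
move=> np q1 Gn; rewrite moment_fun_Mpoly 1?leqW//.
by rewrite [G`_n]nth_default// mulr0 mul0r.
Qed.

(* Expanding against the lower [M_j] replaces positivity of the inner product. *)
Lemma Mpoly_complete n p q G : (2 * n)%:R < p + 1 -> -1 < q -> (size G <= n)%N ->
  (forall F, (size F <= n)%N -> moment_fun p q (G * F) = 0) -> G = 0.
Proof.
elim: n G => [|n IH] G np q1 Gn G0.
  by apply/eqP; rewrite -size_poly_leq0.
(* At size [n.+1] the hypothesis is exactly what M_n requires. *)
have np' : (2 * n)%:R + 1 < p by move: np; rewrite !natrM -natr1; lra.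
suff s : (size G <= n)%N.
  apply: IH => // [|F Fn]; first by lra.
  by apply: G0; exact: leqW.
have := G0 (Mpoly n p q) (size_Mpoly n p q).
rewrite mulrC moment_fun_Mpoly// => /eqP.
have m0 : moment (p - (2 * n)%:R) (q + n%:R) 0 != 0.
  have := Mnorm_gt0 np' q1; rewrite /Mnorm moment_fun_Mpoly ?size_Mpoly//.
  by apply: contraTneq => ->; rewrite mulr0 ltxx.
rewrite mulf_eq0 (negbTE m0) orbF mulf_eq0 pnatr_eq0 gtn_eqF ?fact_gt0//= => /eqP Gn0.
apply/leq_sizeP => j; rewrite leq_eqVlt => /predU1P[<- //|nj].
by rewrite nth_default// (leq_trans Gn).
Qed.

End Rodrigues.

(** * Integration over the sphere *)

Section Wallis.
Context {R : realType}.
Notation mu := (@lebesgue_measure R).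
Implicit Types (k b : nat).

Definition wallis k b : R := \int[mu]_(t in `[0, pi]) (sin t ^+ k * cos t ^+ b).

Lemma continuous_sincos k b : continuous (fun t : R => sin t ^+ k * cos t ^+ b).
Proof.
move=> t; apply: cvgM; apply: (@cvg_comp _ _ _ _ (fun x : R => x ^+ _)).
- exact: continuous_sin.
- exact: exprn_continuous.
- exact: continuous_cos.
- exact: exprn_continuous.
Qed.

Lemma continuous_integrable_itv (f : R -> R) : continuous f ->
  mu.-integrable `[0, pi] (EFin \o f).
Proof.
move=> cf; apply: continuous_compact_integrable; first exact: segment_compact.
exact: continuous_subspaceT.
Qed.

Lemma integrable_sincos k b :
  mu.-integrable `[0, pi] (EFin \o (fun t => sin t ^+ k * cos t ^+ b)).
Proof. by apply: continuous_integrable_itv; exact: continuous_sincos. Qed.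

Lemma wallis_sum (I : Type) (s : seq I) (c : I -> R) (k b : I -> nat) :
  \int[mu]_(t in `[0, pi]) (\sum_(i <- s) c i * (sin t ^+ k i * cos t ^+ b i))
  = \sum_(i <- s) c i * wallis (k i) (b i).
Proof.
(* Integrability is carried through the induction, since additivity of the integral asks for it. *)
suff [] : mu.-integrable `[0, pi]
    (EFin \o (fun t => \sum_(i <- s) c i * (sin t ^+ k i * cos t ^+ b i))) /\
  \int[mu]_(t in `[0, pi]) (\sum_(i <- s) c i * (sin t ^+ k i * cos t ^+ b i))
  = \sum_(i <- s) c i * wallis (k i) (b i) by [].
elim: s => [|i s [IH1 IH2]].
  split.
    rewrite (_ : _ \o _ = cst 0%E); first exact: integrable0.
    by apply/funext => t; rewrite /= big_nil.
  under eq_Rintegral do rewrite big_nil.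
  by rewrite big_nil /Rintegral integral0.
have i1 : mu.-integrable `[0, pi]
    (EFin \o (fun t => c i * (sin t ^+ k i * cos t ^+ b i))).
  have := @integrableZl _ _ _ mu `[0, pi] (measurable_itv _) (c i) _
    (@integrable_sincos (k i) (b i)).
  by apply: eq_integrable => // t _; rewrite /= EFinM.
have EE : (fun t : R => \sum_(j <- i :: s) c j * (sin t ^+ k j * cos t ^+ b j)) =
   (fun t => c i * (sin t ^+ k i * cos t ^+ b i) +
             \sum_(j <- s) c j * (sin t ^+ k j * cos t ^+ b j)).
  by apply/funext => t; rewrite big_cons.
split.
  rewrite EE; have := @integrableD _ _ _ mu `[0, pi] (measurable_itv _) _ _ i1 IH1.
  by apply: eq_integrable => // t _; rewrite /= EFinD.
rewrite EE RintegralD// IH2 big_cons RintegralZl//; exact: integrable_sincos.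
Qed.

Lemma wallis_pythagoras k b : wallis k.+2 b + wallis k b.+2 = wallis k b.
Proof.
rewrite /wallis -RintegralD//; try exact: integrable_sincos.
apply: eq_Rintegral => t _.
by rewrite -[in RHS](mul1r (_ ^+ b)) -(cos2Dsin2 t) -addn2 -(addn2 b) !exprD; ring.
Qed.

Lemma is_derive_sincos k b (t : R) :
  is_derive t (1 : R) (fun t : R => sin t ^+ k.+1 * cos t ^+ b)
    (k.+1%:R * (sin t ^+ k * cos t ^+ b.+1) - b%:R * (sin t ^+ k.+2 * cos t ^+ b.-1)).
Proof.
have D1 := is_deriveX k.+1 (is_derive_sin t).
have D2 := is_deriveX b (is_derive_cos t).
have -> : (fun t : R => sin t ^+ k.+1 * cos t ^+ b) = (sin ^+ k.+1) * (cos ^+ b).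
  by apply/funext => x; rewrite fctE !exprfctE.
have := is_deriveM D1 D2 => D3; apply: is_derive_eq D3 _.
rewrite /GRing.scale /= !exprfctE !exprS; ring.
Qed.

(** The difference of the two sides is the integral of the derivative of sin^(k+1) cos^b, which
    vanishes at 0 and at pi. For b = 0 the truncated exponent [b.-1] has coefficient 0. *)
Lemma wallis_byparts k b :
  k.+1%:R * wallis k b.+1 = b%:R * wallis k.+2 b.-1 :> R.
Proof.
apply/eqP; rewrite -subr_eq0 -mulNr; apply/eqP.
(* The two terms are indexed by booleans to obtain their linear combination from [wallis_sum]. *)
have := @wallis_sum bool [:: true; false] (fun i => if i then k.+1%:R else - b%:R)
  (fun i => if i then k else k.+2) (fun i => if i then b.+1 else b.-1).
rewrite !big_cons big_nil addr0 /= => <-.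
under eq_Rintegral do rewrite !big_cons big_nil addr0 /= mulNr.
rewrite /Rintegral (@continuous_FTC2 _ _ (fun t : R => sin t ^+ k.+1 * cos t ^+ b)).
- by rewrite /= sinpi sin0 !expr0n /= !mul0r subrr.
- exact: pi_gt0.
- apply: continuous_subspaceT => t.
  apply: cvgB; apply: cvgMr; exact: continuous_sincos.
- split.
  + by move=> t _; case: (is_derive_sincos k b t).
  + apply: cvg_at_right_filter; exact: continuous_sincos.
  + apply: cvg_at_left_filter; exact: continuous_sincos.
- by move=> t _; rewrite derive1E; case: (is_derive_sincos k b t).
Qed.

Lemma wallis_cosS k b :
  (k + b + 1)%:R * wallis k b.+1 = b%:R * wallis k b.-1 :> R.
Proof.
case: b => [|b]; first by rewrite addn0 addn1 wallis_byparts !mul0r.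
have := wallis_byparts k b.+1; have := wallis_pythagoras k b.
rewrite /= => <-; rewrite mulrDr => <-; rewrite !natrD -!natr1; ring.
Qed.

Lemma wallis_sinSS k b :
  (k + b + 2)%:R * wallis k.+2 b = k.+1%:R * wallis k b :> R.
Proof.
have := wallis_byparts k b.+1; have := wallis_pythagoras k b.
rewrite /= => <-; rewrite mulrDr => ->; rewrite !natrD -!natr1; ring.
Qed.

End Wallis.

Section Snoc.
Context {R : realType}.

Lemma snoc_widen d (x : 'I_d -> R) t (i : 'I_d) : snoc x t (widen_ord (leqnSn d) i) = x i.
Proof.
rewrite /snoc; case: unliftP => [j|] /(congr1 val) /=.
  rewrite /bump leqNgt ltn_ord add0n => e.
  by congr x; apply: val_inj.
by move=> e; have := ltn_ord i; rewrite e ltnn.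
Qed.

Lemma snoc_max d (x : 'I_d -> R) t : snoc x t ord_max = t.
Proof. by rewrite /snoc unlift_none. Qed.

(** Exponents are plain functions, so that the recursion on the dimension can drop the last one. *)
Definition monomial d (x : 'I_d -> R) (a : 'I_d -> nat) : R := \prod_i x i ^+ a i.

Definition init d (a : 'I_d.+1 -> nat) : 'I_d -> nat :=
  fun i => a (widen_ord (leqnSn d) i).

Lemma monomial_snoc d (x : 'I_d -> R) (s t : R) (a : 'I_d.+1 -> nat) :
  monomial (snoc (fun i => s * x i) t) a =
  s ^+ (\sum_i init a i) * t ^+ a ord_max * monomial x (init a).
Proof.
rewrite /monomial big_ord_recr /= snoc_max.
under eq_bigr do rewrite snoc_widen exprMn.
by rewrite big_split /= prodrXr mulrAC.
Qed.

End Snoc.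

(** * Moments of monomials on the sphere *)

Section SphereMoments.
Context {R : realType}.

(** Follows the recursion of [sphere_integral]: in spherical coordinates a monomial separates, and
    each angle contributes a Wallis integral. *)
Fixpoint sphere_moment (d : nat) : ('I_d -> nat) -> R :=
  match d return ('I_d -> nat) -> R with
  | 0 => fun _ => 0
  | d1.+1 =>
    match d1 return (('I_d1 -> nat) -> R) -> ('I_d1.+1 -> nat) -> R with
    | 0 => fun _ a => 1 + (-1) ^+ a ord0
    | k.+1 => fun rec a =>
        wallis (k + \sum_i init a i) (a ord_max) * rec (init a)
    end (@sphere_moment d1)
  end.

Lemma sphere_momentSS k (a : 'I_k.+2 -> nat) :
  sphere_moment a = wallis (k + \sum_i init a i) (a ord_max) * sphere_moment (init a).
Proof. by []. Qed.

Lemma sphere_integralSS k (f : ('I_k.+2 -> R) -> R) : sphere_integral f =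
  \int[@lebesgue_measure R]_(t in `[0, pi]) (sin t ^+ k *
    sphere_integral (fun xi => f (snoc (fun i => sin t * xi i) (cos t)))).
Proof. by []. Qed.

(** A whole sum goes through the induction on the dimension: [sphere_integral] is not additive on
    arbitrary functions, while here each level only meets sums covered by [wallis_sum]. *)
Lemma sphere_integral_poly d (I : Type) (s : seq I) (c : I -> R) (a : I -> 'I_d -> nat) :
  sphere_integral (fun xi => \sum_(i <- s) c i * monomial xi (a i)) =
  \sum_(i <- s) c i * sphere_moment (a i).
Proof.
elim: d I s c a => [|[|k] IH] I s c a.
- by rewrite /= big1// => i _; rewrite mulr0.
- rewrite /= -big_split /=; apply: eq_bigr => i _.
  by rewrite /monomial !big_ord1 expr1n mulrDr.
transitivity (\int[@lebesgue_measure R]_(t in `[0, pi])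
   \sum_(i <- s) (c i * sphere_moment (init (a i))) *
      (sin t ^+ (k + \sum_j init (a i) j) * cos t ^+ a i ord_max)).
  rewrite sphere_integralSS; apply: eq_Rintegral => t _.
  rewrite (_ : (fun xi => _) = (fun xi : 'I_k.+1 -> R => \sum_(i <- s)
     (c i * (sin t ^+ (\sum_j init (a i) j) * cos t ^+ a i ord_max)) *
     monomial xi (init (a i)))); last first.
    apply/funext => xi; apply: eq_bigr => i _.
    by rewrite monomial_snoc mulrA.
  rewrite IH mulr_sumr; apply: eq_bigr => i _; rewrite exprD; ring.
by rewrite wallis_sum; apply: eq_bigr => i _ /=; ring.
Qed.

(** Spherical coordinates only visit points of norm 1, by sin^2 + cos^2 = 1 in each dimension. This
    is what lets integrals on the cone ignore multiples of [cone_poly]. *)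
Lemma sphere_integral_congr d (f g : ('I_d -> R) -> R) :
  (forall xi, \sum_i xi i ^+ 2 = 1 -> f xi = g xi) ->
  sphere_integral f = sphere_integral g.
Proof.
elim: d f g => [|[|k] IH] f g fg //.
  by rewrite /= !fg// big_ord1 ?expr1n// sqrrN expr1n.
rewrite !sphere_integralSS; apply: eq_Rintegral => t _; congr (_ * _).
apply: IH => xi xi1; apply: fg.
rewrite big_ord_recr /= snoc_max.
under eq_bigr do rewrite snoc_widen exprMn.
by rewrite -mulr_sumr xi1 mulr1 addrC cos2Dsin2.
Qed.

Definition incr d (a : 'I_d -> nat) i : 'I_d -> nat := fun j => (a j + (j == i))%N.
(** Truncation at 0 is harmless in [sphere_moment_incr], where [a i] is a factor. *)
Definition decr d (a : 'I_d -> nat) i : 'I_d -> nat := fun j => (a j - (j == i))%N.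

Lemma sum_incr d (a : 'I_d -> nat) i : (\sum_j incr a i j = (\sum_j a j).+1)%N.
Proof.
rewrite /incr big_split /=.
have -> : (\sum_(j < d) (j == i) = 1)%N.
  by rewrite (bigD1 i)//= eqxx big1// => j /negbTE ->.
by rewrite addn1.
Qed.

Lemma sum_decr d (a : 'I_d -> nat) i : (0 < a i)%N -> (\sum_j decr a i j = (\sum_j a j).-1)%N.
Proof.
move=> ai; rewrite (bigD1 i)//= [in RHS](bigD1 i)//= /decr eqxx.
rewrite (eq_bigr a) => [|j /negbTE ->]; last by rewrite subn0.
by rewrite subn1; case: (a i) ai.
Qed.

(** The divergence theorem on monomials, in dimension e + 1. For the last coordinate it is
    [wallis_cosS]; for the others the induction hypothesis is combined with [wallis_sinSS], because
    the exponent of the sine changes by 2. *)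
Lemma sphere_moment_incr e (a : 'I_e.+1 -> nat) i :
  (\sum_j a j + e)%:R * sphere_moment (incr a i) = (a i)%:R * sphere_moment (decr a i) :> R.
Proof.
elim: e a i => [|e IH] a i.
  rewrite (ord1 i) big_ord1 /= /incr /decr eqxx addn0 addn1 subn1.
  case: (a 0) => [|n]; first by rewrite !mul0r.
  by rewrite /= !exprS; ring.
have neq_max (j : 'I_e.+1) : (widen_ord (leqnSn e.+1) j == ord_max) = false.
  by apply/negbTE; rewrite -val_eqE /= neq_ltn ltn_ord.
have -> : (\sum_j a j = \sum_j init a j + a ord_max)%N by rewrite big_ord_recr.
case: (unliftP ord_max i) => [i' ei|->]; last first.
  have e1 : init (incr a ord_max) = init a.
    by apply/funext => j; rewrite /init /incr neq_max addn0.
  have e2 : init (decr a ord_max) = init a.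
    by apply/funext => j; rewrite /init /decr neq_max subn0.
  rewrite !sphere_momentSS e1 e2 {1}/incr {1}/decr eqxx addn1 subn1 !mulrA.
  rewrite -wallis_cosS; congr (_%:R * _ * _); lia.
have {ei}-> : i = widen_ord (leqnSn e.+1) i'.
  by rewrite ei; apply: val_inj; rewrite /= /bump leqNgt ltn_ord.
have e1 : init (incr a (widen_ord (leqnSn e.+1) i')) = incr (init a) i'.
  by apply/funext => j; rewrite /init /incr -val_eqE.
have e2 : init (decr a (widen_ord (leqnSn e.+1) i')) = decr (init a) i'.
  by apply/funext => j; rewrite /init /decr -val_eqE.
have em1 : incr a (widen_ord (leqnSn e.+1) i') ord_max = a ord_max.
  by rewrite /incr eq_sym neq_max addn0.
have em2 : decr a (widen_ord (leqnSn e.+1) i') ord_max = a ord_max.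
  by rewrite /decr eq_sym neq_max subn0.
have := IH (init a) i'.
rewrite !sphere_momentSS e1 e2 em1 em2 sum_incr.
rewrite -/(init a i'); set k := (\sum_j init a j)%N; set b := a ord_max.
case: (posnP (init a i')) => [a0|a0].
  (* The induction hypothesis makes the moment 0, unless k = e = 0; then the sphere is {1, -1} and
     the exponent 1 is odd. *)
  rewrite a0 !mul0r => /eqP; rewrite mulf_eq0 => /orP[|/eqP ->]; last by rewrite !mulr0.
  rewrite pnatr_eq0 addn_eq0 => /andP[/eqP k0 /eqP e0].
  subst e; rewrite (ord1 i') in a0 *.
  have -> : sphere_moment (incr (init a) 0) = 0 by rewrite /= /incr eqxx a0 expr1 subrr.
  by rewrite !mulr0.
rewrite sum_decr// => h; rewrite -/k.
have k0 : (0 < k)%N by rewrite /k (bigD1 i')//= ltn_addr.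
have := wallis_sinSS (R := R) (e + k.-1) b.
have -> : (e + k.-1).+2 = (e + k.+1)%N by lia.
have -> : (e + k.-1).+1 = (k + e)%N by lia.
have -> : (e + k.-1 + b + 2 = k + b + e.+1)%N by lia.
by move=> hw; rewrite mulrA hw mulrAC h; ring.
Qed.

End SphereMoments.

(** * Harmonic polynomials *)

Section Homogeneous.
Context {R : realType} {d : nat}.
Implicit Types (P Q F G H : {mpoly R[d]}) (m n k s : nat).
Local Notation X_ x := (@mpolyX d R x).
Local Notation x_ i := (@mpolyX d R (mnm1 i)).
Local Notation homog m := (homog_of_degree m).

Lemma homog_ind m (K : {mpoly R[d]} -> Prop) : K 0 ->
  (forall c P Q, K P -> K Q -> K (c *: P + Q)) ->
  (forall x, mdeg x = m -> K (X_ x)) -> forall P, P \is homog m -> K P.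
Proof.
move=> K0 Klin KX P /dhomogP hP; rewrite (mpolyE P) big_seq.
apply: big_ind => //.
  by move=> A B KA KB; rewrite -[A]scale1r; exact: Klin.
by move=> x xP; rewrite -[_ *: _]addr0; apply: Klin => //; apply: KX; exact: hP.
Qed.

Lemma mpolyXU_sub (x : multinom d) i : (0 < x i)%N -> x_ i * X_ (mnm_sub x (mnm1 i)) = X_ x.
Proof.
move=> xi; rewrite -mpolyXD; congr (X_ _); apply/mnmP => j.
rewrite mnmDE mnmBE mnm1E; case: eqP => [<-|_]; last by rewrite subn0.
by rewrite subnKC.
Qed.

Lemma euler m P : P \is homog m -> \sum_i x_ i * mderiv i P = m%:R *: P.
Proof.
move: P; apply: homog_ind => [|c P Q hP hQ|x xm].
- by rewrite scaler0 big1// => i _; rewrite mderiv0 mulr0.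
- rewrite scalerDr scalerA mulrC -scalerA -hP -hQ scaler_sumr -big_split /=.
  by apply: eq_bigr => i _; rewrite mderivD mderivZ mulrDr scalerAr.
rewrite -xm mdegE natr_sum scaler_suml; apply: eq_bigr => i _.
rewrite mderivX -scalerAr; have [->|xi] := posnP (x i); first by rewrite !scale0r.
by rewrite mpolyXU_sub.
Qed.

Lemma mderiv_homog0 i P : P \is homog 0 -> mderiv i P = 0.
Proof.
move: P; apply: homog_ind => [|c P Q hP hQ|x xm]; first exact: mderiv0.
  by rewrite mderivD mderivZ hP hQ scaler0 addr0.
by move/eqP: xm; rewrite mdeg_eq0 => /eqP ->; rewrite mderivX mnm0E scale0r.
Qed.

Lemma mderiv_homogS m i P : P \is homog m.+1 -> mderiv i P \is homog m.
Proof.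
move: P; apply: homog_ind => [|c P Q hP hQ|x xm]; first by rewrite mderiv0 rpred0.
  by rewrite mderivD mderivZ rpredD// rpredZ.
rewrite mderivX; have [->|xi] := posnP (x i); first by rewrite scale0r rpred0.
apply: rpredZ; rewrite dhomogX; apply/eqP/succn_inj; rewrite -xm.
rewrite -[in RHS](_ : mnm_add (mnm1 i) (mnm_sub x (mnm1 i)) = x).
  by rewrite mdegD mdeg1.
apply/mnmP => j; rewrite mnmDE mnmBE mnm1E; case: eqP => [<-|_]; last by rewrite subn0.
by rewrite subnKC.
Qed.

Lemma laplacian_lin c P Q : laplacian (c *: P + Q) = c *: laplacian P + laplacian Q.
Proof.
rewrite /laplacian scaler_sumr -big_split; apply: eq_bigr => i _ /=.
by rewrite !mderivD !mderivZ.
Qed.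

Lemma laplacian0 : laplacian 0 = 0 :> {mpoly R[d]}.
Proof. by apply: big1 => i _; rewrite !mderiv0. Qed.

Lemma laplacianZ c P : laplacian (c *: P) = c *: laplacian P.
Proof. by rewrite -[_ *: P]addr0 laplacian_lin laplacian0 addr0. Qed.

Lemma laplacianB P Q : laplacian (P - Q) = laplacian P - laplacian Q.
Proof. by rewrite addrC -scaleN1r laplacian_lin scaleN1r addrC. Qed.

Lemma laplacian_homogSS m P : P \is homog m.+2 -> laplacian P \is homog m.
Proof. by move=> hP; apply: rpred_sum => i _; do 2 apply: mderiv_homogS. Qed.

Lemma laplacian_homog_lt2 m P : (m < 2)%N -> P \is homog m -> laplacian P = 0.
Proof.
move=> m2 hP; apply: big1 => i _; case: m m2 hP => [|[|//]] _ hP.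
  by rewrite (mderiv_homog0 i hP) mderiv0.
by rewrite mderiv_homog0// mderiv_homogS.
Qed.

Definition r2 : {mpoly R[d]} := \sum_(i < d) x_ i ^+ 2.

Lemma mderiv_r2 i : mderiv i r2 = 2%:R *: x_ i.
Proof.
rewrite /r2 raddf_sum (bigD1 i)//= big1 ?addr0 => [|j ji].
  rewrite expr2 mderivM mderivX mnm1E eqxx scale1r.
  rewrite (_ : X_ _ = 1); first by rewrite mul1r mulr1 scaler_nat.
  by rewrite -mpolyX0; congr (X_ _); apply/mnmP => k; rewrite mnmBE subnn mnm0E.
by rewrite expr2 mderivM mderivX mnm1E (negbTE ji) scale0r mul0r mulr0 addr0.
Qed.

Lemma r2_homog : r2 \is homog 2.
Proof.
apply: rpred_sum => i _; rewrite expr2 -mpolyXD dhomogX /=.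
by rewrite mdegD mdeg1.
Qed.

Lemma r2X_homog m s P : P \is homog m -> r2 ^+ s * P \is homog (s.*2 + m).
Proof.
move=> hP; apply: dhomogM => //.
by have := dhomogMn s r2_homog; rewrite mul2n.
Qed.

(** The gradient of [r2] is 2x, so the cross term is 4 x . grad P = 4m P by Euler's identity, and
    [r2] itself has Laplacian 2d. *)
Lemma laplacian_r2 m P : P \is homog m ->
  laplacian (r2 * P) = r2 * laplacian P + (4 * m + 2 * d)%:R *: P.
Proof.
move=> hP; rewrite natrD scalerDl.
have -> : (4 * m)%:R *: P = \sum_i 4%:R *: (x_ i * mderiv i P).
  by rewrite -scaler_sumr (euler hP) scalerA natrM.
have -> : (2 * d)%:R *: P = \sum_(i < d) 2%:R *: P.
  by rewrite sumr_const card_ord mulnC natrM -scalerA scaler_nat.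
rewrite mulr_sumr -!big_split /=; apply: eq_bigr => i _.
rewrite !mderivM !mderiv_r2 mderivD !mderivM mderivZ mderiv_r2 mderivX mnm1E eqxx scale1r.
rewrite (_ : X_ (mnm_sub _ _) = 1); last first.
  by rewrite -mpolyX0; congr (X_ _); apply/mnmP => k; rewrite mnmBE subnn mnm0E.
rewrite -!scalerAl mul1r !scaler_nat; ring.
Qed.

(** The constant is the sum of 4(2j+m) + 2d over j <= s. *)
Lemma laplacian_r2X m s P : P \is homog m ->
  laplacian (r2 ^+ s.+1 * P) =
  r2 ^+ s.+1 * laplacian P + (2 * s.+1 * (2 * s + d + 2 * m))%:R *: (r2 ^+ s * P).
Proof.
move=> hP; elim: s => [|s IH].
  by rewrite expr1 expr0 mul1r (laplacian_r2 hP); congr (_ + _%:R *: _); lia.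
rewrite exprS -mulrA (laplacian_r2 (r2X_homog _ hP)) IH mulrDr -scalerAr !mulrA.
rewrite -!exprS -addrA -scalerDl -natrD; congr (_ + _%:R *: _); lia.
Qed.

(** By [laplacian_r2X], the Laplacian of r2^(s+1) P is a nonzero multiple of r2^s P plus r2^(s+1)
    times the Laplacian of P. That error has the same form with k lowered by 2 and s raised by 1, so
    induction on k corrects it; hence the general s. *)
Lemma laplacian_solve k s P : (0 < d)%N -> P \is homog k ->
  exists2 G, G \is homog (s.*2 + k) & laplacian (r2 * G) = r2 ^+ s * P.
Proof.
move=> d0; elim/ltn_ind: k s P => k IH s P hP.
pose c : R := (2 * s.+1 * (2 * s + d + 2 * k))%:R.
have c0 : c != 0 by rewrite pnatr_eq0; lia.
have [G hG eG] : exists2 G, G \is homog (s.*2 + k) &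
    laplacian (r2 * G) = r2 ^+ s.+1 * laplacian P.
  case: k IH hP @c c0 => [|[|k]] IH hP c c0.
  - exists 0; rewrite ?rpred0// (laplacian_homog_lt2 _ hP)// !mulr0.
    exact: laplacian0.
  - exists 0; rewrite ?rpred0// (laplacian_homog_lt2 _ hP)// !mulr0.
    exact: laplacian0.
  have [|G hG eG] := IH k _ s.+1 _ (laplacian_homogSS hP); first by [].
  by exists G => //; have -> : (s.*2 + k.+2 = s.+1.*2 + k)%N by lia.
exists (c^-1 *: (r2 ^+ s * P - G)).
  by rewrite rpredZ// rpredB// r2X_homog.
rewrite -scalerAr laplacianZ mulrBr mulrA -exprS laplacianB eG.
by rewrite (laplacian_r2X s hP) -/c addrC addKr scalerA mulVf// scale1r.
Qed.

(** Take G such that r2 G has the same Laplacian as P. *)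
Lemma harmonic_decomposition k P : (0 < d)%N -> P \is homog k.+2 ->
  exists H G, [/\ harmonics d k.+2 H, G \is homog k & P = H + r2 * G].
Proof.
move=> d0 hP; have [G hG eG] := laplacian_solve 0 d0 (laplacian_homogSS hP).
exists (P - r2 * G), G; split=> //; last by rewrite subrK.
split.
  by rewrite rpredB// -[k.+2]/(2 + k)%N; apply: dhomogM => //; exact: r2_homog.
by rewrite laplacianB eG expr0 mul1r subrr.
Qed.

Lemma meval_homog m P (t : R) (x : 'I_d -> R) : P \is homog m ->
  meval (fun i => t * x i) P = t ^+ m * meval x P.
Proof.
move: P; apply: homog_ind => [|c P Q hP hQ|a am]; first by rewrite !meval0 mulr0.
  by rewrite !mevalD !mevalZ hP hQ; ring.
rewrite !mevalX; under eq_bigr do rewrite exprMn.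
by rewrite big_split /= prodrXr -mdegE am.
Qed.

End Homogeneous.

(** * Sphere integrals of polynomials and orthogonality of harmonics *)

Section SphereIntegral.
Context {R : realType} {d : nat}.
Implicit Types (P Q F G H : {mpoly R[d]}) (m n : nat).
Local Notation X_ x := (@mpolyX d R x).
Local Notation x_ i := (@mpolyX d R (mnm1 i)).
Local Notation homog m := (homog_of_degree m).

Definition sphere_int P : R := sphere_integral (fun xi => meval xi P).

Lemma sphere_int_lin c P Q : sphere_int (c *: P + Q) = c * sphere_int P + sphere_int Q.
Proof.
have E F : sphere_int F = \sum_(x <- msupp F) mcoeff x F * sphere_moment (x : 'I_d -> nat).
  rewrite /sphere_int -sphere_integral_poly; congr sphere_integral; apply/funext => xi.
rewrite (E P) (E Q) mulr_sumr.
(* The supports may overlap; the terms are concatenated without collecting them, as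
   [sphere_integral_poly] accepts repeated monomials. *)
pose s := [seq (c * mcoeff x P, x) | x <- msupp P] ++ [seq (mcoeff x Q, x) | x <- msupp Q].
transitivity (\sum_(x <- s) x.1 * sphere_moment (x.2 : 'I_d -> nat) : R).
  rewrite /sphere_int -sphere_integral_poly; congr sphere_integral; apply/funext => xi.
  rewrite mevalD mevalZ !mevalE mulr_sumr /s big_cat !big_map /=.
  by congr (_ + _); apply: eq_bigr => x _; rewrite mulrA.
rewrite /s big_cat !big_map /=.
by congr (_ + _); apply: eq_bigr => x _; rewrite mulrA.
Qed.

Lemma sphere_int0 : sphere_int 0 = 0.
Proof. by have := sphere_int_lin (-1) 0 0; rewrite scaler0 addr0 mulN1r addNr. Qed.

Lemma sphere_intD P Q : sphere_int (P + Q) = sphere_int P + sphere_int Q.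
Proof. by rewrite -[P]scale1r sphere_int_lin mul1r scale1r. Qed.

Lemma sphere_intZ c P : sphere_int (c *: P) = c * sphere_int P.
Proof. by rewrite -[_ *: _]addr0 sphere_int_lin sphere_int0 addr0. Qed.

Lemma sphere_int_sum (I : Type) (r : seq I) (A : pred I) (F : I -> {mpoly R[d]}) :
  sphere_int (\sum_(i <- r | A i) F i) = \sum_(i <- r | A i) sphere_int (F i).
Proof. by apply: (big_morph sphere_int); [exact: sphere_intD|exact: sphere_int0]. Qed.

Lemma sphere_intX (x : multinom d) : sphere_int (X_ x) = sphere_moment (x : 'I_d -> nat).
Proof.
have := @sphere_integral_poly R d _ [:: x] (fun=> 1) (fun x => (x : 'I_d -> nat)).
rewrite big_seq1 mul1r /sphere_int => <-; congr sphere_integral; apply/funext => xi.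
by rewrite big_seq1 mul1r mevalX.
Qed.

(* The divergence theorem on the unit ball, for homogeneous integrands. *)
Lemma sphere_int_mulX n i P : P \is homog n ->
  (n + d.-1)%:R * sphere_int (x_ i * P) = sphere_int (mderiv i P).
Proof.
move: P; apply: homog_ind => [|c P Q hP hQ|x xn].
- by rewrite mulr0 mderiv0 sphere_int0 mulr0.
- by rewrite mulrDr -scalerAr mderivD mderivZ !sphere_int_lin mulrDr -hP -hQ; ring.
rewrite mderivX sphere_intZ -mpolyXD !sphere_intX.
have d0 : (0 < d)%N by case: d i {x xn} => [[]|].
case: d d0 i x xn => [//|e] _ i x xn /=.
have := @sphere_moment_incr R e x i; rewrite -mdegE xn => h.
rewrite (_ : (mnm_add _ _ : 'I_e.+1 -> nat) = incr x i).
  rewrite h; congr (_ * sphere_moment _); apply/funext => j.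
  by rewrite mnmBE mnm1E /decr eq_sym.
by apply/funext => j; rewrite mnmDE mnm1E /incr eq_sym addnC.
Qed.

(** Green's identity: write m P as the sum of x_i d_i P, and apply [sphere_int_mulX] to each d_i P
    Q, of degree m - 1 + m'. The second derivatives of P add up to its Laplacian, which is 0. *)
Lemma sphere_int_gradient m m' P Q : (1 < d)%N -> harmonics d m P -> Q \is homog m' ->
  m%:R * (m + m' + d - 2)%:R * sphere_int (P * Q) =
  \sum_i sphere_int (mderiv i P * mderiv i Q).
Proof.
move=> d1 [hP lP] hQ; case: m hP => [|m] hP.
  rewrite !mul0r big1// => i _.
  by rewrite (mderiv_homog0 i hP) mul0r sphere_int0.
have -> : m.+1%:R * (m.+1 + m' + d - 2)%:R * sphere_int (P * Q) =
    (m + m' + d.-1)%:R * sphere_int ((m.+1%:R *: P) * Q).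
  rewrite -(scalerAl _ P Q) sphere_intZ mulrCA mulrA.
    by have -> : (m.+1 + m' + d - 2 = m + m' + d.-1)%N by lia.
rewrite -(euler hP) mulr_suml sphere_int_sum mulr_sumr.
have e : \sum_i sphere_int (mderiv i (mderiv i P) * Q) = 0.
  by rewrite -sphere_int_sum -mulr_suml -/(laplacian P) lP mul0r sphere_int0.
transitivity (\sum_i (sphere_int (mderiv i (mderiv i P) * Q) +
                     sphere_int (mderiv i P * mderiv i Q)));
  last by rewrite big_split /= e add0r.
apply: eq_bigr => i _.
have hi : mderiv i P * Q \is homog (m + m') by apply: dhomogM => //; exact: mderiv_homogS.
by rewrite -mulrA (sphere_int_mulX i hi) mderivM sphere_intD.
Qed.

(** The gradient side of [sphere_int_gradient] is symmetric, so (m - m')(m + m' + d - 2) times the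
    integral is 0; the second factor is nonzero since m + m' >= 1 and d >= 2. *)
Lemma harmonics_orthogonal m m' P Q : (1 < d)%N -> m != m' ->
  harmonics d m P -> harmonics d m' Q -> sphere_int (P * Q) = 0.
Proof.
move=> d1 mm' hP hQ.
have e1 := sphere_int_gradient d1 hP (proj1 hQ).
have e2 := sphere_int_gradient d1 hQ (proj1 hP).
have e : m%:R * (m + m' + d - 2)%:R * sphere_int (P * Q) =
         m'%:R * (m + m' + d - 2)%:R * sphere_int (P * Q).
  rewrite e1 (addnC m m') (mulrC P Q) e2.
  by apply: eq_bigr => i _; rewrite mulrC.
apply/eqP; move/eqP: e; rewrite -subr_eq0 -mulrBl -mulrBl !mulf_eq0 subr_eq0 eqr_nat.
rewrite (negbTE mm') pnatr_eq0 /= => /orP[|//].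
by move: mm'; lia.
Qed.

End SphereIntegral.

(** * Polynomials on the cone *)

Section ConePolynomials.
Context {R : realType} {d : nat}.
Implicit Types (P Q F : {mpoly R[d.+1]}) (Y : {mpoly R[d]}) (A : {poly R}).
Local Notation tvar := (@mpolyX d.+1 R (mnm1 ord_max)).

Lemma meval_mwiden (x : 'I_d -> R) t Y : meval (snoc x t) (mwiden Y) = meval x Y.
Proof.
rewrite (mpolyE Y); apply: (big_ind (fun Z => meval (snoc x t) (mwiden Z) = meval x Z)).
- by rewrite rmorph0 !meval0.
- by move=> A B hA hB; rewrite mwidenD !mevalD hA hB.
move=> m _; rewrite mwidenZ mwidenX !mevalZ !mevalX big_ord_recr /= mnmwiden_ordmax expr0 mulr1.
by congr (_ * _); apply: eq_bigr => i _; rewrite snoc_widen mnmwiden_widen.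
Qed.

Lemma meval_horner_alg v P A : meval v (horner_alg P A) = A.[meval v P].
Proof.
elim/poly_ind: A => [|A c IH]; first by rewrite rmorph0 meval0 horner0.
rewrite rmorphD rmorphM /= horner_algX horner_algC mevalD mevalM IH mevalZ meval1 mulr1.
by rewrite hornerMXaddC.
Qed.

Lemma horner_algZ P (c : R) A : horner_alg P (c *: A) = c *: horner_alg P A.
Proof. by rewrite -mul_polyC rmorphM /= horner_algC -scalerAl mul1r. Qed.

Lemma cone_ideal_eval P (xi : 'I_d -> R) (t : R) : \sum_i xi i ^+ 2 = 1 ->
  cone_ideal P -> meval (snoc (fun i => t * xi i) t) P = 0.
Proof.
move=> xi1 [Q ->]; rewrite mevalM /cone_poly mevalB meval_mwiden rmorphXn /= mevalXU.
rewrite snoc_max raddf_sum /=.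
under eq_bigr do rewrite rmorphXn /= mevalXU exprMn.
by rewrite -mulr_sumr xi1 mulr1 subrr mulr0.
Qed.

Lemma cone_ideal0 : @cone_ideal R d 0.
Proof. by exists 0; rewrite mul0r. Qed.

Lemma cone_ideal_lin (c : R) P Q : cone_ideal P -> cone_ideal Q -> cone_ideal (c *: P + Q).
Proof. by move=> [A ->] [B ->]; exists (c *: A + B); rewrite mulrDl scalerAl. Qed.

Lemma cone_idealD P Q : cone_ideal P -> cone_ideal Q -> cone_ideal (P + Q).
Proof. by rewrite -[P in P + Q]scale1r; exact: cone_ideal_lin. Qed.

Lemma cone_idealM P Q : cone_ideal Q -> cone_ideal (P * Q).
Proof. by move=> [A ->]; exists (P * A); rewrite mulrA. Qed.

Lemma cone_ideal_r2 Y : cone_ideal (mwiden (r2 * Y) - tvar ^+ 2 * mwiden Y).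
Proof. by exists (mwiden Y); rewrite /cone_poly -/r2 rmorphM /= -mulrBl mulrC. Qed.

Lemma msizeD_leq P Q n : (msize P <= n)%N -> (msize Q <= n)%N -> (msize (P + Q)%R <= n)%N.
Proof. by move=> hP hQ; rewrite (leq_trans (msizeD_le _ _))// geq_max hP. Qed.

Lemma msizeZ_leq (c : R) P n : (msize P <= n)%N -> (msize (c *: P)%R <= n)%N.
Proof. exact: leq_trans (mmeasureZ_le _ _ _). Qed.

(** [size] and [msize] each exceed the degree by one, so the product has degree at most (k-1) + m
    and [msize] at most k + m. *)
Lemma msize_term A Y k m : (size A <= k)%N -> Y \is homog_of_degree m ->
  (msize (horner_alg tvar A * mwiden Y)%R <= k + m)%N.
Proof.
move=> Ak hY; rewrite -(coefK A) poly_def raddf_sum mulr_suml.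
apply: (big_ind (fun P => msize P <= k + m)%N).
- by rewrite mmeasure0.
- by move=> P Q; exact: msizeD_leq.
move=> j _ /=; rewrite horner_algZ -scalerAl; apply: msizeZ_leq.
rewrite rmorphXn /= horner_algX.
move: Y hY; apply: homog_ind => [|c Y Z hY hZ|x xm].
- by rewrite rmorph0 mulr0 mmeasure0.
- by rewrite mwidenD mwidenZ mulrDr -scalerAr msizeD_leq// msizeZ_leq.
rewrite mwidenX mpolyXn -mpolyXD mmeasureX /= mdegD -xm -addSn leq_add//.
  rewrite mdegMn mdeg1 mul1n; exact: leq_trans Ak.
by rewrite !mdegE big_ord_recr /= mnmwiden_ordmax addn0 leq_sum// => i _; rewrite mnmwiden_widen.
Qed.

Lemma mpolyX_last (x : multinom d.+1) :
  exists a : multinom d, @mpolyX _ R x = tvar ^+ x ord_max * mwiden (@mpolyX _ R a) /\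
   (mdeg x = x ord_max + mdeg a)%N.
Proof.
pose a : multinom d := Multinom [tuple x (widen_ord (leqnSn d) i) | i < d].
have e : x = mnm_add (mnm_muln (mnm1 ord_max) (x ord_max)) (mnmwiden a).
  apply/mnmP => j; rewrite mnmDE mulmnE mnm1E.
  case: (unliftP ord_max j) => [i ->|->].
    have -> : lift ord_max i = widen_ord (leqnSn d) i.
      by apply: val_inj; rewrite /= /bump leqNgt ltn_ord.
    rewrite mnmwiden_widen mnmE.
    by rewrite -val_eqE /= gtn_eqF ?ltn_ord// mul0n.
  by rewrite eqxx mul1n mnmwiden_ordmax addn0.
exists a; split.
  by rewrite {1}e mpolyXD -mpolyXn mwidenX.
rewrite !mdegE big_ord_recr /= addnC; congr (_ + _)%N.
by apply: eq_bigr => i _; rewrite mnmE.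
Qed.

End ConePolynomials.

(** * Harmonic expansions on the cone and the orthogonal basis *)

Section HarmonicExpansion.
Context {R : realType} {d : nat} (dimH : nat -> nat).
Context (Y : forall m : nat, 'I_(dimH m) -> {mpoly R[d]}).
Context (hd : (1 < d)%N) (hY : forall m : nat, orthonormal_harmonic_basis m (@Y m)).
Implicit Types (P Q F : {mpoly R[d.+1]}) (A : {poly R}) (N n m k : nat).
Local Notation tvar := (@mpolyX d.+1 R (mnm1 ord_max)).
Local Notation I_ N := {m : 'I_N.+1 & 'I_(dimH m)}.

Definition basisY N (i : I_ N) : {mpoly R[d]} := @Y (tag i) (tagged i).

Definition idx N m (mN : (m < N.+1)%N) (l : 'I_(dimH m)) : I_ N :=
  existT (fun m : 'I_N.+1 => 'I_(dimH m)) (Ordinal mN) l.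

Lemma idx_eq N m m' (mN : (m < N.+1)%N) (mN' : (m' < N.+1)%N)
    (l : 'I_(dimH m)) (l' : 'I_(dimH m')) :
  (idx mN l == idx mN' l') = (m == m') && (l == l' :> nat).
Proof.
apply/eqP/andP => [e|[/eqP mm']].
  split; first by apply/eqP; exact: (congr1 (fun i : I_ N => nat_of_ord (tag i)) e).
  by apply/eqP; exact: (congr1 (fun i : I_ N => nat_of_ord (tagged i)) e).
subst m'; move=> /eqP/val_inj ->.
by rewrite /idx (bool_irrelevance mN mN').
Qed.

Definition expand N (b : I_ N -> {poly R}) : {mpoly R[d.+1]} :=
  \sum_i horner_alg tvar (b i) * mwiden (basisY i).

Definition expand1 N (i0 : I_ N) A : I_ N -> {poly R} :=
  fun i => if i == i0 then A else 0.

Lemma expand_expand1 N (i0 : I_ N) A :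
  expand (expand1 i0 A) = horner_alg tvar A * mwiden (basisY i0).
Proof.
rewrite /expand (bigD1 i0)//= /expand1 eqxx big1 ?addr0// => i /negbTE ->.
by rewrite rmorph0 mul0r.
Qed.

(** [k] bounds [msize]: a term b_i(t) Y_i(x) then has degree below k, and the truncated subtraction
    forces b_i = 0 once the degree of Y_i reaches k. *)
Definition decomposes N k Q := exists2 b : I_ N -> {poly R},
  (forall i, size (b i) <= k - tag i)%N & cone_ideal (Q - expand b).

Lemma expand_lin N (c : R) (a b : I_ N -> {poly R}) :
  expand (fun i => c *: a i + b i) = c *: expand a + expand b.
Proof.
rewrite /expand scaler_sumr -big_split /=; apply: eq_bigr => i _.
by rewrite rmorphD /= horner_algZ mulrDl scalerAl.
Qed.

Lemma expand0 N : expand (fun _ : I_ N => 0) = 0.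
Proof. by apply: big1 => i _; rewrite rmorph0 mul0r. Qed.

Lemma decomposes0 N k : decomposes N k 0.
Proof.
exists (fun=> 0); first by move=> i; rewrite size_poly0.
by rewrite expand0 subr0; exact: cone_ideal0.
Qed.

Lemma decomposes_lin N k c P Q :
  decomposes N k P -> decomposes N k Q -> decomposes N k (c *: P + Q).
Proof.
move=> [a sa ha] [b sb hb]; exists (fun i => c *: a i + b i).
  move=> i; rewrite (leq_trans (size_polyD _ _))// geq_max sb andbT.
  exact: leq_trans (size_scale_leq _ _) _.
rewrite expand_lin opprD addrACA -scalerBr; exact: cone_ideal_lin.
Qed.

Lemma decomposes_congr N k P Q :
  cone_ideal (P - Q) -> decomposes N k Q -> decomposes N k P.
Proof.
move=> PQ [b sb hb]; exists b => //.
by rewrite -[P](subrK Q) -addrA; exact: cone_idealD.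
Qed.

Lemma decomposes_tvar N k j Q : decomposes N k Q -> decomposes N (j + k) (tvar ^+ j * Q).
Proof.
move=> [b sb hb]; exists (fun i => 'X^j * b i).
  (* If [b i] is nonzero then [tag i < k] and the differences add up; otherwise [k - tag i] may be
     truncated. *)
  move=> i; have [bi|bi] := posnP (size (b i)).
    by move/eqP: bi; rewrite size_poly_eq0 => /eqP ->; rewrite mulr0 size_poly0.
  rewrite (leq_trans (size_polyMleq _ _))// size_polyXn /=.
  by rewrite -addnBA ?leq_add2l// ltnW// -subn_gt0 (leq_trans bi).
rewrite (_ : expand _ = tvar ^+ j * expand b); first by rewrite -mulrBr; exact: cone_idealM.
rewrite /expand mulr_sumr; apply: eq_bigr => i _.
by rewrite rmorphM rmorphXn /= horner_algX mulrA.
Qed.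

Lemma decomposes_leq N k k' Q : (k <= k')%N -> decomposes N k Q -> decomposes N k' Q.
Proof.
by move=> kk' [b sb hb]; exists b => // i; rewrite (leq_trans (sb i))// leq_sub2r.
Qed.

Lemma decomposes_harmonic N m (H : {mpoly R[d]}) : (m <= N)%N -> harmonics d m H ->
  decomposes N m.+1 (mwiden H).
Proof.
move=> mN hH; have [[_ _ /(_ H hH)[c /= ec]] _] := hY m.
move/eqP: ec; rewrite subr_eq0 => /eqP ->; rewrite raddf_sum /=.
apply: (big_ind (decomposes N m.+1)); first exact: decomposes0.
  by move=> P Q hP hQ; rewrite -[P]scale1r; exact: decomposes_lin.
move=> l _; rewrite mwidenZ -[_ *: _]addr0.
apply: decomposes_lin; last exact: decomposes0.
exists (expand1 (idx (mN : m < N.+1)%N l) 1).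
  move=> i; rewrite /expand1; case: eqP => [->|_]; last by rewrite size_poly0.
  by rewrite size_poly1 /= subSnn.
by rewrite expand_expand1 rmorph1 mul1r subrr; exact: cone_ideal0.
Qed.

(** Write F = H + r2 G. On the cone r2 G becomes t^2 G with G of degree m - 2, where the induction
    applies. *)
Lemma decomposes_homog N m (F : {mpoly R[d]}) : (m <= N)%N ->
  F \is homog_of_degree m -> decomposes N m.+1 (mwiden F).
Proof.
elim/ltn_ind: m F => m IH F mN hF.
have small : (m < 2)%N -> decomposes N m.+1 (mwiden F).
  move=> m2; apply: decomposes_harmonic => //; split => //.
  exact: laplacian_homog_lt2 m2 hF.
case: m IH mN hF small => [|[|m]] IH mN hF small; try exact: small.
have [H [G [hH hG ->]]] := harmonic_decomposition (ltnW hd) hF.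
rewrite mwidenD -[mwiden H]scale1r; apply: decomposes_lin; first exact: decomposes_harmonic.
apply: decomposes_congr (cone_ideal_r2 G) _.
apply: (@decomposes_tvar _ m.+1 2); apply: IH => //.
exact: leq_trans (leqW (leqnSn _)) mN.
Qed.

Lemma decomposes_msize N k Q : (k <= N.+1)%N -> (msize Q <= k)%N -> decomposes N k Q.
Proof.
move=> kN Qk; rewrite (mpolyE Q) big_seq.
apply: (big_ind (decomposes N k)); first exact: decomposes0.
  by move=> A B hA hB; rewrite -[A]scale1r; exact: decomposes_lin.
move=> x /msize_mdeg_lt xQ; have xk : (mdeg x < k)%N by exact: leq_trans xQ Qk.
rewrite -[_ *: _]addr0; apply: decomposes_lin; last exact: decomposes0.
have [a [-> xa]] := @mpolyX_last R d x.
apply: (@decomposes_leq _ (x ord_max + (mdeg a).+1)%N); first by rewrite addnS -xa.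
apply: decomposes_tvar; apply: decomposes_homog; last by rewrite dhomogX.
by rewrite -ltnS (leq_trans _ kN)// (leq_trans _ xk)// ltnS xa leq_addl.
Qed.

Lemma sphere_area_neq0 : sphere_area d != 0 :> R.
Proof.
have d0 : 0 < d%:R / 2 :> R by rewrite divr_gt0// ltr0n ltnW.
by rewrite gt_eqF// divr_gt0 ?Gamma_gt0// mulr_gt0// powR_gt0// pi_gt0.
Qed.

Lemma sphere_int_basisY N (i j : I_ N) :
  sphere_int (basisY i * basisY j) = sphere_area d * (i == j)%:R.
Proof.
have sE (A B : {mpoly R[d]}) : sphere_int (A * B) = sphere_area d * sphere_inner A B.
  rewrite /sphere_inner mulVKf ?sphere_area_neq0// /sphere_int; congr sphere_integral.
  by apply/funext => xi; rewrite mevalM.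
case: i j => [m l] [m' l']; rewrite /basisY /=.
have [e|mm'] := eqVneq m m'.
  by subst m'; rewrite sE; have [_ ->] := hY m; rewrite eq_Tagged.
rewrite (_ : (existT _ _ _ == _) = false) ?mulr0; last first.
  by apply: contra_neqF mm' => /eqP/(congr1 tag).
apply: (@harmonics_orthogonal _ _ m m') => //.
  by have [[hh _ _] _] := hY m; exact: hh.
by have [[hh _ _] _] := hY m'; exact: hh.
Qed.

Lemma meval_expand N (b : I_ N -> {poly R}) P (t : R) (xi : 'I_d -> R) :
  \sum_i xi i ^+ 2 = 1 -> cone_ideal (P - expand b) ->
  meval (snoc (fun i => t * xi i) t) P =
  \sum_i (b i).[t] * t ^+ tag i * meval xi (basisY i).
Proof.
move=> xi1 /(cone_ideal_eval t xi1)/eqP; rewrite mevalB subr_eq0 => /eqP ->.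
rewrite /expand raddf_sum /=; apply: eq_bigr => i _.
rewrite mevalM meval_horner_alg mevalXU snoc_max meval_mwiden.
have [[hh _ _] _] := hY (tag i).
by rewrite (meval_homog _ _ (proj1 (hh (tagged i)))) mulrA.
Qed.

(** Absorbs the Jacobian t^(d-1) of the cone measure into the weight. *)
Lemma weight_shift (p q t : R) : 0 < t ->
  t ^+ d.-1 * weight p q t = weight (p - d%:R + 1) (q + d%:R - 1) t.
Proof.
move=> t0; rewrite weightE// /weight.
have -> : d.-1%:R = d%:R - 1 :> R.
  by rewrite -[in RHS](prednK (ltnW hd)) -natr1 addrK.
have -> : p - d%:R + 1 + (q + d%:R - 1) = p + q by ring.
by rewrite addrA.
Qed.

(** For fixed t the spherical integral keeps only the diagonal terms, by orthonormality of the
    harmonics. What remains is one radial integral per index, whose factor t^(2m) shifts the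
    parameters. *)
Lemma cone_innerE N (p q : R) (a b : I_ N -> {poly R}) P Q :
  (2 * N + d)%:R < p -> - d%:R < q ->
  (forall i, size (a i) <= N.+1 - tag i)%N -> (forall i, size (b i) <= N.+1 - tag i)%N ->
  cone_ideal (P - expand a) -> cone_ideal (Q - expand b) ->
  cone_inner p q P Q = c_const (p - d%:R + 1) (q + d%:R - 1) *
   \sum_(i : I_ N) moment_fun (p - (2 * tag i)%:R - d%:R + 1)
     (q + (2 * tag i)%:R + d%:R - 1) (a i * b i).
Proof.
move=> hp hq sa sb hP hQ.
pose p0 := p - d%:R + 1; pose q0 := q + d%:R - 1.
(* The power 2m comes from homogeneity: each of the two harmonics at t xi gives a factor t^m. *)
pose F : {poly R} := \sum_(i : I_ N) 'X^(2 * tag i) * (a i * b i).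
have q01 : -1 < q0 by rewrite /q0; lra.
(* Each summand has degree at most 2m + 2(N-m) = 2N, and p > 2N + d gives p0 > 2N + 1. *)
have Fp : (size F)%:R < p0.
  apply: (@le_lt_trans _ _ (2 * N + 1)%:R); last by move: hp; rewrite /p0 !natrD; lra.
  rewrite ler_nat; apply: leq_trans (size_sum _ _ _) _.
  apply/bigmax_leqP => i _; apply: leq_trans (size_polyMleq _ _) _.
  rewrite size_polyXn; move: (size_polyMleq (a i) (b i)) (sa i) (sb i) (ltn_ord (tag i)).
  move: (size (a i * b i)) (size (a i)) (size (b i)) (nat_of_ord (tag i)) => s1 s2 s3 m.
  lia.
have [Fi FI] := integral_moment_fun q01 Fp.
have sph t : sphere_integral (fun xi => meval (snoc (fun i => t * xi i) t) P *
    meval (snoc (fun i => t * xi i) t) Q * weight p q t) =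
    sphere_area d * (F.[t] * weight p q t).
  transitivity (sphere_int (\sum_i \sum_j (weight p q t * ((a i).[t] * t ^+ tag i) *
      ((b j).[t] * t ^+ tag j)) *: (basisY i * basisY j))).
    apply: sphere_integral_congr => xi xi1.
    rewrite (meval_expand t xi1 hP) (meval_expand t xi1 hQ) raddf_sum /= mulr_suml mulr_suml.
    apply: eq_bigr => i _; rewrite raddf_sum /= mulr_sumr mulr_suml; apply: eq_bigr => j _.
    by rewrite mevalZ mevalM; ring.
  rewrite sphere_int_sum /F horner_sum mulr_suml mulr_sumr; apply: eq_bigr => i _.
  rewrite sphere_int_sum (bigD1 i)//= sphere_intZ sphere_int_basisY eqxx big1 ?addr0 => [|j ji]; last first.
    by rewrite sphere_intZ sphere_int_basisY eq_sym (negbTE ji) !mulr0.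
  by rewrite mulr1 !hornerM hornerXn mul2n -addnn exprD; ring.
rewrite /cone_inner /cone_integral.
under eq_Rintegral do rewrite sph.
(* The powers of t only combine for t > 0; the endpoint 0 is then dropped from the integral. *)
have E : {in `]0, +oo[%classic, (fun t : R => t ^+ d.-1 * (sphere_area d * (F.[t] * weight p q t)))
    =1 (fun t => sphere_area d * (F.[t] * weight p0 q0 t))}.
  move=> t; rewrite inE /= in_itv /= andbT => t0.
  by rewrite -weight_shift//; ring.
rewrite -Rintegral_itv_obnd_cbnd; last first.
  have := @integrableZl _ _ _ (@lebesgue_measure R) `]0, +oo[ (measurable_itv _) (sphere_area d) _ Fi.
  apply: eq_integrable => // t ht; rewrite /= -EFinM; congr EFin; exact/esym/E.
rewrite (_ : Rintegral _ _ _ = sphere_area d * moment_fun p0 q0 F); last first.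
  by rewrite -FI -RintegralZl//; exact: eq_Rintegral.
rewrite mulrAC mulKf ?sphere_area_neq0// mulrC.
congr (_ * _); rewrite moment_fun_sum; apply: eq_bigr => i _.
rewrite moment_fun_mulXn; have -> : p0 - (2 * tag i)%:R = p - (2 * tag i)%:R - d%:R + 1.
  by rewrite /p0; ring.
by have -> : q0 + (2 * tag i)%:R = q + (2 * tag i)%:R + d%:R - 1 by rewrite /q0; ring.
Qed.

Lemma SpolyE N (p q : R) n m (mN : (m < N.+1)%N) (l : 'I_(dimH m)) :
  Spoly p q n m (Y l) = expand (expand1 (idx mN l)
    (Mpoly (n - m) (p - (2 * m)%:R - d%:R + 1) (q + (2 * m)%:R + d%:R - 1))).
Proof. by rewrite expand_expand1. Qed.

Lemma cone_ideal_subrr P : cone_ideal (P - P).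
Proof. by rewrite subrr; exact: cone_ideal0. Qed.

Lemma size_expand1 N (i0 i : I_ N) A :
  (size A <= N.+1 - tag i0)%N -> (size (expand1 i0 A i) <= N.+1 - tag i)%N.
Proof. by rewrite /expand1; case: eqP => [->|_ _] //; rewrite size_poly0. Qed.

Lemma sum_expand1 N (i0 : I_ N) (a : I_ N -> {poly R}) A (p q : I_ N -> R) :
  \sum_i moment_fun (p i) (q i) (a i * expand1 i0 A i) = moment_fun (p i0) (q i0) (a i0 * A).
Proof.
rewrite (bigD1 i0)//= /expand1 eqxx big1 ?addr0// => i /negbTE ->.
by rewrite mulr0 moment_fun0.
Qed.

Context (p q : R).
Local Notation p_ m := (p - (2 * m)%:R - d%:R + 1).
Local Notation q_ m := (q + (2 * m)%:R + d%:R - 1).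
Context (hq : - d%:R < q).

Lemma shifted_q_gt m : -1 < q_ m.
Proof. have := ler0n R (2 * m); move: hq; lra. Qed.

Lemma shifted_p_gt N m : (2 * N + d)%:R < p -> (m <= N)%N -> (2 * (N - m))%:R + 1 < p_ m.
Proof. by move=> hp mN; move: hp; rewrite mulnBr natrB ?leq_mul2l// natrD; lra. Qed.

Lemma c_const_gt0 (a b : R) : 1 < a -> -1 < b -> 0 < c_const a b.
Proof. by move=> a1 b1; rewrite divr_gt0 ?mulr_gt0 ?Gamma_gt0//; lra. Qed.

Lemma cone_inner_Spoly n n' m m' (l : 'I_(dimH m)) (l' : 'I_(dimH m')) :
  (2 * maxn n n' + d)%:R < p -> (m <= n)%N -> (m' <= n')%N ->
  cone_inner p q (Spoly p q n m (Y l)) (Spoly p q n' m' (Y l')) =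
  H_const d p q m n * (n == n')%:R * (l == l' :> nat)%:R * (m == m')%:R.
Proof.
(* Both polynomials are expanded over the common index set for N, so that [cone_innerE] applies to
   the pair. *)
move=> hp mn mn'; set N := maxn n n' in hp.
have nN : (n <= N)%N by exact: leq_maxl.
have nN' : (n' <= N)%N by exact: leq_maxr.
have mN : (m < N.+1)%N by rewrite ltnS (leq_trans mn).
have mN' : (m' < N.+1)%N by rewrite ltnS (leq_trans mn').
rewrite (SpolyE _ _ _ mN) (SpolyE _ _ _ mN').
rewrite (@cone_innerE N p q _ _ _ _ hp hq _ _ (cone_ideal_subrr _) (cone_ideal_subrr _)); last 2 first.
- move=> i; apply: size_expand1; apply: leq_trans (size_Mpoly _ _ _) _.
  by rewrite subSn// ltnS leq_sub2r.
- move=> i; apply: size_expand1; apply: leq_trans (size_Mpoly _ _ _) _.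
  by rewrite subSn// ltnS leq_sub2r.
rewrite (@sum_expand1 N (idx mN' l') _ _ (fun i => p_ (tag i)) (fun i => q_ (tag i))).
rewrite /expand1 eq_sym idx_eq /=.
have [mm'|_] := eqVneq m m'; last by rewrite mul0r moment_fun0 !mulr0.
have [ll'|_] := eqVneq (l : nat) l'; last by rewrite mul0r moment_fun0 !(mulr0, mul0r).
subst m'; rewrite /= !mulr1.
have pn k : (m <= k)%N -> (k <= N)%N -> (2 * (k - m))%:R + 1 < p_ m.
  move=> mk kN; apply: shifted_p_gt => //; apply: le_lt_trans hp.
  by rewrite ler_nat leq_add2r leq_mul2l.
have q1 := shifted_q_gt m.
have [nn'|nn'] := eqVneq n n'.
  (* The ratio of constants in [H_const] trades the univariate normalization inside [h_const] for
     that of the cone. *)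
  rewrite -nn' mulr1 /H_const -(MnormE (pn n mn nN) q1).
  rewrite -mulrA; congr (_ * _); rewrite mulKf// gt_eqF// c_const_gt0//.
  by have := pn n mn nN; have := ler0n R (2 * (n - m)); lra.
(* The factor of higher degree acts as the orthogonal polynomial, the other as a test polynomial. *)
rewrite mulr0; case: (ltngtP n n') nn' => // [lt|lt] _.
  rewrite [X in moment_fun _ _ X]mulrC Mpoly_orthogonal ?mulr0//; first exact: pn.
  by apply: leq_trans (size_Mpoly _ _ _) _; rewrite ltn_sub2r// (leq_ltn_trans mn).
rewrite Mpoly_orthogonal ?mulr0//; first exact: pn.
by apply: leq_trans (size_Mpoly _ _ _) _; rewrite ltn_sub2r// (leq_ltn_trans mn').
Qed.

(** Pairing with a basis element isolates one radial coefficient. Independence follows from the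
    positive norm of M_i; for spanning, orthogonality to lower degrees forces each radial
    coefficient to be a multiple of M_i. *)
Lemma orthogonal_basis_Spoly n : (2 * n + d)%:R < p ->
  orthogonal_basis_Vspace p q n
    (fun i : I_ n => Spoly p q n (tag i) (@Y (tag i) (tagged i))).
Proof.
move=> hp.
pose M (i : I_ n) := Mpoly (n - tag i) (p_ (tag i)) (q_ (tag i)).
have tn (i : I_ n) : (tag i <= n)%N by rewrite -ltnS.
have pn (i : I_ n) := shifted_p_gt hp (tn i).
have sM (i : I_ n) : (size (M i) <= n.+1 - tag i)%N.
  by rewrite subSn// size_Mpoly.
have SE (i : I_ n) : Spoly p q n (tag i) (Y (tagged i)) = expand (expand1 i (M i)).
  by rewrite expand_expand1.
have c0 : c_const (p - d%:R + 1) (q + d%:R - 1) != 0.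
  rewrite gt_eqF// c_const_gt0//; last by move: hq; lra.
  by move: hp; rewrite natrD; have := ler0n R (2 * n); lra.
have inner_term (P : {mpoly R[d.+1]}) (b : I_ n -> {poly R}) (i : I_ n) A :
    cone_ideal (P - expand b) -> (forall j, size (b j) <= n.+1 - tag j)%N ->
    (size A <= n.+1 - tag i)%N ->
    cone_inner p q P (horner_alg tvar A * mwiden (basisY i)) =
    c_const (p - d%:R + 1) (q + d%:R - 1) * moment_fun (p_ (tag i)) (q_ (tag i)) (b i * A).
  move=> hP sb sA; rewrite -expand_expand1.
  rewrite (@cone_innerE n p q b _ _ _ hp hq sb _ hP (cone_ideal_subrr _)); last first.
    by move=> j; exact: size_expand1.
  by rewrite (@sum_expand1 n i _ _ (fun i => p_ (tag i)) (fun i => q_ (tag i))).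
have yhom (i : I_ n) : basisY i \is homog_of_degree (tag i).
  by have [[hh _ _] _] := hY (tag i); exact: proj1 (hh _).
split; last first.
  move=> i j ij; rewrite cone_inner_Spoly ?maxnn//.
  move: i j ij => [[m mN] l] [[m' mN'] l'] /= ij.
  have : (m == m') && (l == l' :> nat) = false.
    by rewrite -(idx_eq mN mN'); exact: negbTE ij.
  by case: (m == m') => /= [->|_]; rewrite ?mulr0 ?mul0r.
split.
- move=> i; split.
    exists (Spoly p q n (tag i) (Y (tagged i))); last exact: cone_ideal_subrr.
    rewrite SE expand_expand1; have := msize_term (sM i) (yhom i).
    by rewrite subnK// leqW.
  (* As Q has degree below n, its radial coefficients have degree below that of the M_i. *)
  move=> Q Qn; have [b sb hb] := decomposes_msize (leqnSn n) Qn.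
  rewrite SE (@cone_innerE n p q _ b _ _ hp hq _ _ (cone_ideal_subrr _) hb); last 2 first.
  - by move=> j; exact: size_expand1.
  - by move=> j; rewrite (leq_trans (sb j))// leq_sub2r.
  under eq_bigr do rewrite mulrC.
  rewrite (@sum_expand1 n i _ _ (fun i => p_ (tag i)) (fun i => q_ (tag i))).
  by rewrite (mulrC (b i)) Mpoly_orthogonal ?mulr0 ?shifted_q_gt.
- move=> c hc i.
  have e : \sum_i c i *: Spoly p q n (tag i) (Y (tagged i)) = expand (fun i => c i *: M i).
    rewrite /expand; apply: eq_bigr => j _.
    by rewrite SE expand_expand1 horner_algZ scalerAl.
  (* The combination now has two expansions, by 0 and by the c_i M_i; the inner product with the
     i-th element is computed from both. *)
  have h0 : cone_ideal (\sum_i c i *: Spoly p q n (tag i) (Y (tagged i)) -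
      expand (fun _ : I_ n => 0)).
    by rewrite expand0 subr0.
  have s0 (j : I_ n) : (size (0%R : {poly R}) <= n.+1 - tag j)%N by rewrite size_poly0.
  have := inner_term _ _ i (M i) h0 s0 (sM i).
  rewrite e (@inner_term _ (fun i => c i *: M i) i (M i) (cone_ideal_subrr _) _ (sM i)); last first.
    by move=> j; exact: leq_trans (size_scale_leq _ _) _.
  move/eqP; rewrite mul0r moment_fun0 mulr0 mulf_eq0 (negbTE c0) /= -scalerAl moment_funZ mulf_eq0.
  by have /gt_eqF -> := Mnorm_gt0 (pn i) (shifted_q_gt (tag i)); rewrite orbF => /eqP.
move=> v [[Q Qn vQ] v0].
have [b sb hb] : decomposes n n.+1 v.
  by apply: decomposes_congr vQ _; exact: decomposes_msize.
(* Chosen so that b_i - c_i M_i loses its coefficient of degree n - m; [Mpoly_complete] then shows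
   that it is 0. *)
pose c (i : I_ n) := (b i)`_(n - tag i) / (M i)`_(n - tag i).
have lead0 i : (M i)`_(n - tag i) != 0.
  rewrite coef_Mpoly gt_eqF// rising_gt0//.
  by have := pn i; have : (0 : R) <= 1 by []; lra.
exists c.
suff bE i : b i = c i *: M i.
  rewrite (_ : \sum_i _ = expand b)//; apply: eq_bigr => i _.
  by rewrite SE expand_expand1 bE horner_algZ scalerAl.
apply/eqP; rewrite -subr_eq0; apply/eqP.
apply: (@Mpoly_complete _ (n - tag i) (p_ (tag i)) (q_ (tag i))).
- by have := pn i; lra.
- exact: shifted_q_gt.
- apply/leq_sizeP => j; rewrite leq_eqVlt => /predU1P[<-|nj].
    by rewrite coefB coefZ /c divfK// subrr.
  rewrite coefB coefZ !nth_default ?mulr0 ?subr0//.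
    by rewrite (leq_trans (sM i))// subSn.
  by rewrite (leq_trans (sb i))// subSn.
move=> F Fn; rewrite mulrBl moment_funD moment_funN -scalerAl moment_funZ.
rewrite Mpoly_orthogonal ?mulr0 ?subr0 ?shifted_q_gt//.
(* F(t) Y_i(x) has degree below n, so v is orthogonal to it, which makes b_i orthogonal to F for the
   radial weight. *)
have hF : (msize (horner_alg tvar F * mwiden (basisY i))%R <= n)%N.
  by have := msize_term Fn (yhom i); rewrite subnK.
have := v0 _ hF; rewrite (inner_term _ b)//; last by rewrite subSn// leqW.
by move/eqP; rewrite mulf_eq0 (negbTE c0) => /eqP.
Qed.

End HarmonicExpansion.

Theorem proposition3p8 (R : realType) (d n n' : nat) (p q : R)
    (dimH : nat -> nat) (Y : forall m : nat, 'I_(dimH m) -> {mpoly R[d]})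
    (hd : (2 <= d)%N)
    (hp : (2 * maxn n n' + d)%:R < p) (hq : - d%:R < q)
    (hY : forall m : nat, orthonormal_harmonic_basis m (@Y m)) :
  orthogonal_basis_Vspace p q n
    (fun i : {m : 'I_n.+1 & 'I_(dimH m)} =>
       Spoly p q n (tag i) (@Y (tag i) (tagged i))) /\
  forall (m m' : nat) (l : 'I_(dimH m)) (l' : 'I_(dimH m')),
    (m <= n)%N -> (m' <= n')%N ->
    cone_inner p q (Spoly p q n m (@Y m l)) (Spoly p q n' m' (@Y m' l')) =
    H_const d p q m n * (n == n')%:R * (l == l' :> nat)%:R * (m == m')%:R.
Proof.
split; last by move=> m m' l l'; exact: cone_inner_Spoly.
apply: orthogonal_basis_Spoly => //; apply: le_lt_trans hp.
by rewrite ler_nat leq_add2r leq_mul2l leq_maxl.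
Qed.
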